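(* For every positive integer $d$ and every $\alpha\ge1$, the class $\mathcal{C}^d_\alpha$ has asymptotic dimension at most $2d+2$.
   Context: The height of a bounded convex set $X\subseteq\mathbb{R}^d$ is the infimum of $h\ge0$ such that $X$ lies between two parallel hyperplanes at distance $h$; its aspect ratio is its diameter divided by its height. $\mathcal{C}^d_\alpha$ is the class of connected (finite) intersection graphs of systems of path-connected sets in $\mathbb{R}^d$, each of which is obtained from a compact convex set of aspect ratio at most $\alpha$ by removing some subset of its interior. For a graph with shortest-path metric, a family $\mathcal U$ of vertex sets is $D$-bounded if each member has diameter at most $D$, and $r$-disjoint if vertices in different members are at distance $>r$. An $n$-dimensional control function for a class $\mathcal C$ is $D:\mathbb{R}_+\to\mathbb{R}_+$ such that for all $G\in\mathcal C$ and $r>0$, $V(G)$ has a cover $\bigcup_{i=1}^{n+1}\mathcal U_i$ with each $\mathcal U_i$ $r$-disjoint and all members $D(r)$-bounded; the asymptotic dimension of $\mathcal C$ is the least such $n$. *)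

(* Defs.v *)
(* with the concrete Stdlib reals [Rdefinitions.R]
   (a realType via Rstruct).  Points of R^d are row vectors 'rV[R]_d with the
   product topology of mathcomp-analysis (= Euclidean topology); distances
   are Euclidean. *)
From mathcomp Require Import all_boot all_order all_algebra.
From mathcomp Require Import all_classical all_reals all_analysis.
From mathcomp Require Import Rstruct Rstruct_topology.
Import Order.TTheory GRing.Theory Num.Theory.

Set Implicit Arguments.
Unset Strict Implicit.
Unset Printing Implicit Defensive.

Local Open Scope classical_set_scope.
Local Open Scope ring_scope.

Notation RR := Rdefinitions.R.

Definition dotp (d : nat) (u v : 'rV[RR]_d) : RR := \sum_(i < d) u 0 i * v 0 i.

Definition enorm (d : nat) (u : 'rV[RR]_d) : RR := Num.sqrt (dotp u u).

Definition edist (d : nat) (x y : 'rV[RR]_d) : RR := enorm (x - y).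

Definition convex_set (d : nat) (X : set 'rV[RR]_d) : Prop :=
  forall x y t, X x -> X y -> 0 <= t <= 1 -> X ((1 - t) *: x + t *: y).

Definition diam (d : nat) (X : set 'rV[RR]_d) : RR :=
  sup [set edist x y | x in X & y in X].

Definition between_hyperplanes (d : nat) (X : set 'rV[RR]_d) (h : RR) : Prop :=
  exists (u : 'rV[RR]_d) (c : RR),
    enorm u = 1 /\ forall x, X x -> c <= dotp u x <= c + h.

Definition height (d : nat) (X : set 'rV[RR]_d) : RR :=
  inf [set h | 0 <= h /\ between_hyperplanes X h].

Definition aspect_ratio_le (d : nat) (X : set 'rV[RR]_d) (alpha : RR) : Prop :=
  diam X <= alpha * height X.

Definition path_connected (d : nat) (S : set 'rV[RR]_d) : Prop :=
  forall x y, S x -> S y ->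
    exists f : RR -> 'rV[RR]_d,
      {within `[0, 1], continuous f} /\ f 0 = x /\ f 1 = y /\
      (forall t, 0 <= t <= 1 -> S (f t)).

Definition admissible_set (d : nat) (alpha : RR) (S : set 'rV[RR]_d) : Prop :=
  path_connected S /\
  exists (K Z : set 'rV[RR]_d),
    compact K /\ convex_set K /\ aspect_ratio_le K alpha /\
    Z `<=` K° /\ S = K `\` Z.

Fixpoint walk (T : Type) (adj : T -> T -> Prop) (k : nat) (x y : T) : Prop :=
  match k with
  | 0 => x = y
  | k'.+1 => exists z, adj x z /\ walk adj k' z y
  end.

Definition graph_connected (T : Type) (adj : T -> T -> Prop) : Prop :=
  forall x y, exists k, walk adj k x y.

(* shortest-path distance (the least length of a walk; only used on
   connected graphs) *)
Definition gdist (T : Type) (adj : T -> T -> Prop) (x y : T) : RR :=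
  inf [set (k%:R : RR) | k in [set k | walk adj k x y]].

Definition bounded_family (T : Type) (adj : T -> T -> Prop)
    (U : set (set T)) (D : RR) : Prop :=
  forall A, U A -> forall x y, A x -> A y -> gdist adj x y <= D.

Definition disjoint_family (T : Type) (adj : T -> T -> Prop)
    (U : set (set T)) (r : RR) : Prop :=
  forall A B, U A -> U B -> A <> B ->
    forall x y, A x -> B y -> r < gdist adj x y.

Definition good_cover (T : Type) (adj : T -> T -> Prop) (n : nat) (r D : RR) : Prop :=
  exists U : 'I_n.+1 -> set (set T),
    (forall x : T, exists i A, U i A /\ A x) /\
    (forall i, disjoint_family adj (U i) r) /\
    (forall i, bounded_family adj (U i) D).

Definition inter_adj (d m : nat) (S : 'I_m -> set 'rV[RR]_d) (i j : 'I_m) : Prop :=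
  i <> j /\ S i `&` S j !=set0.

Definition in_class (d : nat) (alpha : RR) (m : nat)
    (S : 'I_m -> set 'rV[RR]_d) : Prop :=
  (forall i, admissible_set alpha (S i)) /\ graph_connected (inter_adj S).

Definition control_function (d : nat) (alpha : RR) (n : nat) (D : RR -> RR) : Prop :=
  (forall r, 0 < r -> 0 <= D r) /\
  forall (m : nat) (S : 'I_m -> set 'rV[RR]_d), in_class alpha S ->
    forall r, 0 < r -> good_cover (inter_adj S) n r (D r).

Definition asdim_le (d : nat) (alpha : RR) (n : nat) : Prop :=
  exists D : RR -> RR, control_function d alpha n D.

(* Main.v *)
(* A set of bounded aspect ratio contains a ball of comparable radius, so in a
   bounded region of scale s only boundedly many sets of size at least s are
   pairwise far apart in the graph, apart from long chains of nested sets sitting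
   in each other's holes.

   Let r be given, and let rho(v) be the largest size of a set within distance r
   of v. Use d + 1 shifted hierarchical grids, chosen so that every point is deep
   inside a cell of some grid at every scale. Assign to v a grid in which v is deep
   inside its cell of scale about rho(v). Among the vertices assigned to one grid,
   vertices at distance at most r have nested cells, so the laminar family of cells
   yields a tree decomposition of the r-th power graph, and by packing each bag is
   covered by N sets of bounded diameter. Such a coarse tree decomposition of width
   N gives a 2-colouring with bounded monochromatic components, by induction on N:
   near a bag X colour the rim and then a thick shell around X by hand; the bags
   still meeting a neighbourhood of X need only N - 1 sets outside the shell, and
   below the maximal bags far from X one starts afresh, the merging this causes
   being recorded by torso edges. This uses 2 (d + 1) colours.

   Chains of nested sets are dealt with by layers of the distance l from a vertex
   v0 lying in no hole. A vertex v in a hole of w has dist v w <= l v + 2 - l w, so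
   holes of sets in nearby layers are harmless and only deep holes matter. The
   collection of deep holes containing v is locally constant except at the start of
   a layer, where one more colour is used for the vertices for which a hole has just
   become deep. *)
Require Import Defs.
From mathcomp Require Import all_boot all_order all_algebra.
From mathcomp Require Import all_classical all_reals all_analysis.
From mathcomp Require Import Rstruct Rstruct_topology.
From mathcomp Require Import perm lra ring zify.
From Stdlib Require Import Relation_Operators.
Import Order.TTheory GRing.Theory Num.Theory.
Set Implicit Arguments.
Unset Strict Implicit.
Unset Printing Implicit Defensive.

Local Notation chain := (clos_refl_trans_n1 _).

(** * Chains and coarse coverings *)

Section Chains.
Variable T : Type.
Implicit Types R : T -> T -> Prop.

Lemma chain0 R x : chain R x x.
Proof. exact: rtn1_refl. Qed.

Lemma chainS R x y z : chain R x y -> R y z -> chain R x z.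
Proof. by move=> xy yz; apply: rtn1_trans xy. Qed.

Lemma chain_sub R R' x y :
  (forall a b, R a b -> R' a b) -> chain R x y -> chain R' x y.
Proof.
by move=> sRR'; elim=> [|b c /sRR' bc _]; [exact: chain0|exact: rtn1_trans].
Qed.

Lemma chain_trans R x y z : chain R x y -> chain R y z -> chain R x z.
Proof. by move=> xy; elim=> // b c bc _; exact: rtn1_trans. Qed.

Lemma chain1 R x y : R x y -> chain R x y.
Proof. by move=> xy; apply: rtn1_trans xy _; exact: chain0. Qed.

Lemma chain_sym R x y : (forall a b, R a b -> R b a) -> chain R x y -> chain R y x.
Proof.
move=> symR; elim=> [|b c /symR cb _]; first exact: chain0.
by move=> bx; apply: chain_trans bx; exact: chain1.
Qed.

Lemma chain_avoid R (C : T -> Prop) x y : chain R x y ->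
  (exists2 p, C p & chain R x p /\ chain R p y) \/
  (~ C x /\ chain (fun a b => [/\ R a b, ~ C a & ~ C b]) x y).
Proof.
move=> xy; have [Cx|nCx] := pselect (C x).
  by left; exists x => //; split => //; exact: chain0.
suff [?|[? _]] : (exists2 p, C p & chain R x p /\ chain R p y) \/
  (chain (fun a b => [/\ R a b, ~ C a & ~ C b]) x y /\ ~ C y).
- by left.
- by right.
elim: xy => [|b c bc xb [[p Cp [xp pb]]|[IH nCb]]].
- by right; split => //; exact: chain0.
- by left; exists p => //; split => //; exact: rtn1_trans pb.
- have [Cc|nCc] := pselect (C c).
    left; exists c => //; split; last exact: chain0.
    exact: rtn1_trans xb.
  by right; split => //; apply: rtn1_trans IH.
Qed.

End Chains.

Definition nat_metric (T : Type) (d : T -> T -> nat) :=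
  [/\ forall x, d x x = 0, forall x y, d x y = d y x &
      forall x y z, d x z <= d x y + d y z].

Definition covered (T : Type) (d : T -> T -> nat) (N q : nat) (X : T -> Prop) :=
  exists cl : T -> nat, (forall x, X x -> cl x < N) /\
    forall x y, X x -> X y -> cl x = cl y -> d x y <= q.

Section Metric.
Variables (T : Type) (d : T -> T -> nat).
Hypothesis dm : nat_metric d.

Lemma covered_sub N q (X Y : T -> Prop) :
  (forall x, Y x -> X x) -> covered d N q X -> covered d N q Y.
Proof.
move=> YX [cl [clN clq]]; exists cl; split=> [x /YX|x y /YX + /YX]; first exact: clN.
exact: clq.
Qed.

(** Points farther than [q] from [x0] avoid the class of [x0]; its number passes to the last
    class. *)
Lemma covered_drop N q (X : T -> Prop) x0 : X x0 -> covered d N.+1 q X ->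
  covered d N q (fun u => X u /\ q < d x0 u).
Proof.
move=> Xx0 [cl [clN clq]].
have ne u : X u -> q < d x0 u -> cl u <> cl x0.
  by move=> Xu qu /esym /(clq _ _ Xx0 Xu); lia.
exists (fun u => if cl u == N then cl x0 else cl u); split=> [u [Xu qu]|u v [Xu qu] [Xv qv]].
  have := clN _ Xu; have := clN _ Xx0; have := ne _ Xu qu.
  by case: eqP; lia.
move: (ne _ Xu qu) (ne _ Xv qv) (clq _ _ Xu Xv).
by case: eqP; case: eqP => ? ? ? ? H ?; apply: H; lia.
Qed.

(* Leave the class of the starting point once and for all; the rest of the chain
   lives in one class less. *)
Lemma cover_chain N q s (X : T -> Prop) x y : covered d N q X ->
  chain (fun a b => [/\ X a, X b & d a b <= s]) x y -> d x y <= N * (q + s).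
Proof.
have [d0 dC dt] := dm.
elim: N X x y => [|N IH] X x y cX xy.
  have [cl [clN _]] := cX.
  case: xy => [|b c [_ Xc _] _]; first by rewrite d0.
  by have := clN _ Xc.
have [Xx|nXx] := pselect (X x); last first.
  elim: xy => [|b c [Xb Xc _] bx]; first by rewrite d0.
  suff : X x by [].
  by elim: bx Xb => // b' c' [Xb' _ _] _ IHb _; exact: IHb.
have cX' := covered_drop Xx cX.
set X' := fun u => _ in cX'.
suff [|[y0 y0q y0y]] : d x y <= q \/ exists2 y0, d x y0 <= q + s &
    chain (fun a b => [/\ X' a, X' b & d a b <= s]) y0 y.
- by rewrite mulSn; lia.
- by have := IH _ _ _ cX' y0y; have := dt x y0 y; rewrite mulSn; lia.
elim: xy => [|b c [Xb Xc bc] _ IHb]; first by left; rewrite d0.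
have [cq|cq] := leqP (d x c) q; first by left.
right; have [bq|bq] := leqP (d x b) q.
  by exists c; [have := dt x b c; lia|exact: chain0].
case: IHb => [|[y0 y0q y0b]]; first by lia.
by exists y0 => //; apply: (chainS y0b).
Qed.

(** An excursion outside [C] has diameter at most [B] and is entered and left by steps of length at
    most [e], so the successive visits to [C] are jumps of length at most [B + 2 * e]. *)
Lemma chain_shadow (R : T -> T -> Prop) (C : T -> Prop) B e p y :
  (forall a b, R a b -> d a b <= e) ->
  (forall a b, chain (fun a b => [/\ R a b, ~ C a & ~ C b]) a b -> d a b <= B) ->
  C p -> chain R p y ->
  exists2 r, chain (fun a b => [/\ C a, C b & d a b <= B + 2 * e]) p r &
    d r y <= B + e.
Proof.
have [d0 dC dt] := dm.
move=> Re RB Cp py.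
suff [r pr [[ry Cy]|[a [[Cr ra] nCa ay]]]] : exists2 r,
    chain (fun a b => [/\ C a, C b & d a b <= B + 2 * e]) p r &
    (r = y /\ C y) \/
    exists a, [/\ C r /\ d r a <= e, ~ C y & chain (fun a b => [/\ R a b, ~ C a & ~ C b]) a y].
- by exists r => //; rewrite ry d0.
- by exists r => //; have := RB _ _ ay; have := dt r a y; lia.
elim: py => [|b c bc _ [r pr [[rb Cb]|[a [[Cr ra] nCb ab]]]]].
- by exists p; [exact: chain0|left].
- have [Cc|nCc] := pselect (C c).
    exists c; last by left.
    by apply: (chainS pr); rewrite rb; split=> //; have := Re _ _ bc; lia.
  exists r; first by [].
  right; exists c; split => //; last exact: chain0.
  by split; rewrite rb //; exact: Re.
- have [Cc|nCc] := pselect (C c).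
    exists c; last by left.
    apply: (chainS pr); split=> //.
    by have := Re _ _ bc; have := RB _ _ ab; have := dt r a b; have := dt r b c; lia.
  by exists r => //; right; exists a; split => //; apply: (chainS ab).
Qed.

End Metric.

(** * Colouring coarse tree decompositions *)

Definition mono_step (T C : Type) (U : T -> Prop) (G : T -> T -> Prop)
    (chi : T -> C) (a b : T) := [/\ U a, U b, chi a = chi b & G a b].

Definition mono_bounded (T C : Type) (d : T -> T -> nat) (U : T -> Prop)
    (G : T -> T -> Prop) (chi : T -> C) (F : nat) :=
  forall x y, chain (mono_step U G chi) x y -> d x y <= F.

(* The bag of [v] in the tree decomposition of the graph [G] on [U] given by a
   forest order: the vertices at or above [v] with a neighbour at or below [v]. *)
Definition bag (T : Type) (U : T -> Prop) (le G : T -> T -> Prop) (v u : T) :=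
  [/\ U u, le v u & exists y, [/\ U y, le y v & G u y]].

Definition forest_order (T : Type) (le : T -> T -> Prop) :=
  [/\ forall x, le x x, forall x y z, le x y -> le y z -> le x z &
      forall u a b, le u a -> le u b -> le a b \/ le b a].

Definition comparability_graph (T : Type) (d : T -> T -> nat) (U : T -> Prop)
    (le G : T -> T -> Prop) (e : nat) :=
  [/\ forall x, G x x, forall x y, G x y -> G y x &
      forall x y, U x -> U y -> G x y -> (le x y \/ le y x) /\ d x y <= e].

(** * The induction step on the number of sets covering a bag *)

Section TreeStep.
Variables (T : finType) (d : T -> T -> nat) (U : T -> Prop).
Variables (le G : T -> T -> Prop) (N e q f : nat).
Hypothesis dm : nat_metric d.
Hypothesis le_forest : forest_order le.
Hypothesis G_cmp : comparability_graph d U le G e.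

(** [D1] bounds chains of jumps of length [3 * e] in a bag, [H1] chains that start in
    [close_to (2 * e + q)] and make excursions of diameter at most [f]. [F] adds two distances from
    a vertex in no lost part. *)
Let D1 := N.+1 * (q + 3 * e).
Let H1 := N.+1 * (q + 2 * (2 * e + q) + (f + 2 * e)) + (f + e).
Let F := 2 * (D1 + e + f + 2 * H1).

Hypothesis G_cov : forall v, U v -> covered d N.+1 q (bag U le G v).
Hypothesis IH : forall (U' : T -> Prop) G',
  comparability_graph d U' le G' (e + D1) ->
  (forall v, U' v -> covered d N q (bag U' le G' v)) ->
  exists chi : T -> bool, mono_bounded d U' G' chi f.

Definition rim (D : T -> Prop) (x : T) := D x /\ exists z, [/\ U z, ~ D z & G x z].

(* [true] is the colour forced on the rim of [D], and it must not leave the rim. *)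
Definition rim_coloring (D : T -> Prop) (chi : T -> bool) :=
  [/\ forall x, rim D x -> chi x,
      forall x y, rim D x -> D y -> ~ rim D y -> G x y -> ~~ chi y &
      mono_bounded d D G chi F].

Definition below (t u : T) := U u /\ le u t.

Lemma exists_maximal (P : T -> Prop) t : P t ->
  exists m, [/\ P m, le t m & forall t', P t' -> le m t' -> le t' m].
Proof.
have [le0 let_ _] := le_forest.
have [k] := ubnP #|[set u | ~~ `[<le u t>]]|.
elim: k t => // k IHk t; rewrite ltnS => kt Pt.
have [[t' [Pt' tt' t't]]|noP] :=
  pselect (exists t', [/\ P t', le t t' & ~ le t' t]); last first.
  exists t; split => // t' Pt' tt'; apply: contrapT => t't.
  by apply: noP; exists t'.
have [||m [Pm t'm mmax]] := IHk t'; [|by []|by exists m; split => //; exact: let_ t'm].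
apply: leq_trans kt; apply: proper_card; apply/properP; split.
  apply/fintype.subsetP => u; rewrite !finset.in_set; apply: contra => /asboolP ut.
  by apply/asboolP; exact: let_ tt'.
exists t'; rewrite !finset.in_set; first exact/asboolP.
by rewrite negbK; exact/asboolP.
Qed.

Section Extend.
Variables (D X0 : T -> Prop).
Hypothesis DU : forall x, D x -> U x.
Hypothesis D_down : forall x y, D x -> U y -> le y x -> D y.
Hypothesis X0_cov : covered d N.+1 q X0.
Hypothesis D_rim : forall z y, U z -> ~ D z -> D y -> G y z -> X0 z.

Definition close_to (s : nat) (x : T) := exists2 z, X0 z & d x z <= s.
Definition lost (t : T) := D t /\ forall x, bag U le G t x -> ~ close_to (2 * e) x.

Hypothesis lost_coloring : forall t, lost t -> exists chi, rim_coloring (below t) chi.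

Definition lostmax (t v : T) :=
  [/\ lost t, forall t', lost t' -> le t t' -> le t' t & le v t].

Definition tau (v : T) : option T := [pick t | `[<lostmax t v>]].

Lemma tau_some v t : tau v = Some t -> lostmax t v.
Proof. by rewrite /tau; case: pickP => // t' /asboolP h [<-]. Qed.

Lemma tau_none v t : tau v = None -> lost t -> ~ le v t.
Proof.
rewrite /tau; case: pickP => // h _ /[dup] Lt /exists_maximal[m [Lm tm mmax]] vt.
have [_ let_ _] := le_forest.
by have /asboolP := h m; apply; split => //; exact: let_ tm.
Qed.

(** Vertices above [u] are pairwise comparable, so [lostmax] holds of the same vertices for [u] and
    for [v], and [pick] makes the same choice. *)
Lemma tau_le u v t : le u v -> tau v = Some t -> tau u = Some t.
Proof.
have [le0 let_ lef] := le_forest.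
move=> uv vt; rewrite -vt; apply: eq_pick => m.
have [Lt tmax let'] := tau_some vt.
apply/asboolP/asboolP => -[Lm mmax um]; split => //; last exact: let_ um.
have [mt|tm] := lef _ _ _ um (let_ _ _ _ uv let').
  by apply: let_ let' _; exact: mmax.
exact: let_ tm.
Qed.

(** Edges join comparable vertices, so an edge leaving the part below [t] goes upwards and ends in
    the bag of [t]. *)
Lemma tau_step a b t : U a -> U b -> G a b -> tau a = Some t ->
  tau b = Some t \/
  [/\ tau b = None, bag U le G t b, ~ below t b & rim (below t) a].
Proof.
have [le0 let_ lef] := le_forest; have [G0 Gs Gc] := G_cmp.
move=> Ua Ub ab at_; have [Lt tmax a_t] := tau_some at_.
have [cab _] := Gc _ _ Ua Ub ab.
case btau : (tau b) => [t'|].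
  left; case: cab => [ab'|ba]; first by rewrite -at_ (tau_le ab' btau).
  by rewrite -btau (tau_le ba at_).
right; have nbt : ~ le b t := tau_none btau Lt.
have ab' : le a b by case: cab => // ba; case: nbt; exact: let_ a_t.
have tb : le t b by have [|/nbt] := lef _ _ _ a_t ab'.
have nb : ~ below t b by case.
split => //; first by split => //; exists a; split => //; exact: Gs.
by split => //; exists b.
Qed.

Lemma rim_close x : rim D x -> close_to e x.
Proof.
have [_ _ Gc] := G_cmp; move=> [Dx [z [Uz nDz xz]]].
by exists z; [exact: D_rim xz|have [_] := Gc _ _ (DU Dx) Uz xz].
Qed.

Lemma close_toW s s' x : s <= s' -> close_to s x -> close_to s' x.
Proof. by move=> ss' [z Xz xz]; exists z => //; exact: leq_trans ss'. Qed.

Lemma rim_top x : rim D x -> tau x = None.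
Proof.
have [le0 let_ lef] := le_forest; have [G0 Gs Gc] := G_cmp.
move=> [Dx [z [Uz nDz xz]]]; case xt : (tau x) => [t|//].
have [Lt tmax x_t] := tau_some xt; have [Dt far] := Lt.
have [zt|[zN bz _ _]] := tau_step (DU Dx) Uz xz xt.
  by have [_ _ zt'] := tau_some zt; case: nDz; exact: D_down zt'.
case: (far _ bz); exists z; last by have [-> _ _] := dm.
exact: D_rim xz.
Qed.

Lemma rim_nbr_top x y : rim D x -> D y -> G x y -> tau y = None.
Proof.
have [G0 Gs Gc] := G_cmp.
move=> rx Dy xy; have xN := rim_top rx; have [Dx _] := rx.
case yt : (tau y) => [t|//].
have [|[_ bx _ _]] := tau_step (DU Dy) (DU Dx) (Gs _ _ xy) yt; first by rewrite xN.
have [[_ far] _ _] := tau_some yt; case: (far _ bx).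
by apply: close_toW (rim_close rx); lia.
Qed.

Definition rest x := [/\ D x, tau x = None & ~ close_to (2 * e + q) x].

(** The added edges stand for chains running through a lost part. *)
Definition torso x y := G x y \/
  (exists t, [/\ lost t, bag U le G t x & bag U le G t y]) /\ d x y <= D1.

(** One class is saved: [v] is not lost, so its bag has a vertex [x] within [2 * e] of [X0], and
    vertices of [rest] are farther than [q] from [x]. Torso edges do not enlarge the bag, since a
    vertex in the bag of a lost [t] already has a neighbour at or below [t]. *)
Lemma rest_coloring : exists chi : T -> bool, mono_bounded d rest torso chi f.
Proof.
have [le0 let_ lef] := le_forest; have [G0 Gs Gc] := G_cmp.
have [d0 dC dt] := dm.
apply: IH => [|v [Dv vN farv]].
  split=> [x|x y [/Gs ?|[[t [Lt tx ty]] xy]]|x y [/DU Ux _ _] [/DU Uy _ _]].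
  - by left; exact: G0.
  - by left.
  - by right; split; [exists t|rewrite dC].
  - move=> [xy|[[t [Lt [_ tx _] [_ ty _]]] xy]].
      by have [? ?] := Gc _ _ Ux Uy xy; split => //; lia.
    by split; [exact: lef tx ty|lia].
have [x bx [z X0z xz]] : exists2 x, bag U le G v x & close_to (2 * e) x.
  apply: contrapT => nobag; apply: (tau_none vN _ (le0 v)); split => // x bx cx.
  by apply: nobag; exists x.
apply: covered_sub (covered_drop bx (G_cov (DU Dv))).
move=> u [[Du uN faru] vu [y [[Dy yN fary] yv uy]]]; split; last first.
  by rewrite ltnNge; apply/negP => xu; apply: faru; exists z => //;
    have := dt u x z; rewrite (dC u x); lia.
case: uy => [uy|[[t [Lt [Uu tu [y' [Uy' y't uy']]] [Uy ty _]]] _]].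
  by split=> //; [exact: DU|exists y; split=> //; exact: DU].
by split=> //; exists y'; split=> //; exact: let_ (let_ _ _ _ y't ty) yv.
Qed.

Lemma covered_close s : covered d N.+1 (q + 2 * s) (close_to s).
Proof.
have [d0 dC dt] := dm; have [cl [clN clq]] := X0_cov.
have /choice[z zP] : forall x, exists z, close_to s x -> X0 z /\ d x z <= s.
  move=> x; have [[z Xz xz]|nx] := pselect (close_to s x); first by exists z.
  by exists x.
exists (cl \o z); split=> [x /zP[/clN]//|x y /zP[Xx xz] /zP[Xy yz] /(clq _ _ Xx Xy) zq].
have := dt x (z x) y; have := dt (z x) (z y) y; rewrite (dC (z y) y); lia.
Qed.

Lemma rim_below_bag t c : U t -> rim (below t) c ->
  exists2 z, bag U le G t z & d c z <= e.
Proof.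
have [le0 let_ lef] := le_forest; have [G0 Gs Gc] := G_cmp.
move=> Ut [[Uc ct] [z [Uz nzt cz]]]; have [cmp cze] := Gc _ _ Uc Uz cz.
have nle : ~ le z t by move=> zt; apply: nzt; split.
exists z => //; split => //; last by exists c; split=> //; exact: Gs.
have cz' : le c z by case: cmp => // zc; case: nle; exact: let_ ct.
by have [|/nle] := lef _ _ _ ct cz'.
Qed.

Lemma extend_coloring : exists chi : T -> bool, rim_coloring D chi.
Proof.
have [le0 let_ lef] := le_forest; have [G0 Gs Gc] := G_cmp.
have [d0 dC dt] := dm.
have /choice[X XP] : forall t, exists chi, lost t -> rim_coloring (below t) chi.
  move=> t; have [/lost_coloring[chi chiP]|nt] := pselect (lost t); first by exists chi.
  by exists (fun=> true).
have [chiR chiRP] := rest_coloring.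
(* Lost parts keep their own colourings, the rim is [true], the shell around [X0] is [false], and
   [rest] is coloured by the induction hypothesis. *)
pose chi v := if tau v is Some t then X t v else
  if `[<rim D v>] then true else
  if `[<close_to (2 * e + q) v>] then false else chiR v.
have chi_lost v t : tau v = Some t -> chi v = X t v by rewrite /chi => ->.
have chi_rim v : rim D v -> chi v.
  by move=> rv; rewrite /chi rim_top //; case: asboolP.
have chi_close v : tau v = None -> ~ rim D v -> close_to (2 * e + q) v -> chi v = false.
  by move=> vN nrv cv; rewrite /chi vN; case: asboolP => // _; case: asboolP.
have rim_cl v : rim D v -> close_to (2 * e + q) v.
  by move=> /rim_close; apply: close_toW; lia.
have chi_rest v : rest v -> chi v = chiR v.
  move=> [Dv vN nc]; rewrite /chi vN; case: asboolP => [/rim_cl//|_].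
  by case: asboolP.
have restP v : D v -> tau v = None -> ~ rim D v -> chi v -> rest v.
  by move=> Dv vN nrv cv; split => // cl; rewrite chi_close in cv.
have nbr_rim x y : rim D x -> D y -> ~ rim D y -> G x y -> ~~ chi y.
  move=> rx Dy nry xy; rewrite chi_close //; first exact: rim_nbr_top xy.
  have [z X0z xz] := rim_close rx; exists z => //.
  have [Dx _] := rx; have [_] := Gc _ _ (DU Dx) (DU Dy) xy.
  by have := dt y x z; rewrite (dC y x); lia.
exists chi; split => //.
pose R := mono_step D G chi.
have Rs a b : R a b -> R b a by case=> Da Db ab gab; split => //; exact: Gs.
have Re a b : R a b -> d a b <= e.
  by case=> /DU Ua /DU Ub _ gab; have [] := Gc _ _ Ua Ub gab.
(* A component is measured from a vertex [p] outside the lost parts; one without such a vertex stays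
   in a single lost part, where [F] is known to bound it. *)
suff top p y : tau p = None -> chain R p y -> d p y <= D1 + e + f + 2 * H1.
  move=> x y /(chain_avoid (fun v => tau v = None))[[p pN [xp py]]|[xS]].
    have := top _ _ pN py; have := top _ _ pN (chain_sym Rs xp).
    by have := dt x p y; rewrite (dC x p) /F; lia.
  case xt : (tau x) xS => [t|//] _ xy.
  have [Lt _ _] := tau_some xt; have [_ _ bnd] := XP _ Lt.
  suff [_] : tau y = Some t /\ chain (mono_step (below t) G (X t)) x y by exact: bnd.
  elim: xy => [|b c [[Db Dc bcC bc] bN cN] _ [bt xb]]; first by split=> //; exact: chain0.
  have [ct|[//]] := tau_step (DU Db) (DU Dc) bc bt.
  split => //; apply: (chainS xb); split => //.
  - by have [] := tau_some bt; split => //; exact: DU.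
  - by have [] := tau_some ct; split => //; exact: DU.
  - by rewrite -(chi_lost _ _ bt) -(chi_lost _ _ ct).
move=> pN py.
have [[Dp chip]|] : (D p /\ forall c, chain R p c -> D c /\ chi c = chi p) \/ p = y.
- have [Dp|nDp] := pselect (D p).
    left; split => // c; elim=> // a b [Da Db abC _] _ [_ <-]; by [].
  by right; elim: py => // a b [Da _ _ _] _ pa; rewrite pa in nDp.
(* The rim is [true] and its neighbours in [D] off the rim are [false], so this component stays on
   the rim, within [e] of [X0]. *)
- have [rp|nrp] := pselect (rim D p).
    suff : chain (fun a b => [/\ close_to e a, close_to e b & d a b <= e]) p y.
      by move=> /(cover_chain dm (covered_close e)); rewrite /D1; lia.
    suff [] : rim D y /\ chain (fun a b => [/\ close_to e a, close_to e b & d a b <= e]) p y by [].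
    elim: py => [|a b ab pa [ra IHa]]; first by split=> //; exact: chain0.
    have [_ Db _ gab] := ab; have [_ chib] := chip b (chainS pa ab).
    have rb : rim D b.
      apply: contrapT => nrb; have := nbr_rim _ _ ra Db nrb gab.
      by rewrite chib chi_rim.
    by split=> //; apply: (chainS IHa); split; [exact: rim_close|exact: rim_close|exact: Re].
  have [red|blue] := boolP (chi p); last first.
    (* A [false] component cannot enter a lost part, whose rim is [true]; away from the shell it is
       coloured by [chiR]. *)
    pose Rb a b := [/\ R a b, tau a = None, tau b = None & ~~ chi a].
    have topP c : chain R p c -> tau c = None /\ chain Rb p c.
      elim=> [|a b ab pa [aN IHa]]; first by split=> //; exact: chain0.
      have [Da Db abC gab] := ab; have [_ chia] := chip a pa.
      suff bN : tau b = None by split=> //; apply: (chainS IHa); split; rewrite ?chia.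
      case bt : (tau b) => [t|//].
      have [|[_ _ _ rb]] := tau_step (DU Db) (DU Da) (Gs _ _ gab) bt; first by rewrite aN.
      have [Lt _ _] := tau_some bt; have [red _ _] := XP _ Lt.
      by move: (red _ rb); rewrite -(chi_lost _ _ bt) -abC chia (negbTE blue).
    have [_ {}py] := topP _ py.
    pose C := close_to (2 * e + q).
    have Rbs a b : Rb a b -> Rb b a.
      by case=> ab aN bN nca; split=> //; [exact: Rs|case: ab => _ _ <-].
    have Rbe a b : Rb a b -> d a b <= e by case=> /Re.
    have restC a b : chain (fun a b => [/\ Rb a b, ~ C a & ~ C b]) a b -> d a b <= f.
      move=> ab; apply: chiRP; apply: chain_sub ab => {}a {}b [[[Da Db abC gab] aN bN _] na nb].
      by split=> //; [rewrite -!chi_rest|left].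
    have fromC z c : C z -> chain Rb z c -> d z c <= H1.
      move=> Cz zc; have [r zr rc] := chain_shadow dm Rbe restC Cz zc.
      have := cover_chain dm (covered_close _) zr; have := dt z r c.
      by rewrite /H1; lia.
    case: (chain_avoid C py) => [[z Cz [pz zy]]|[_ /restC]]; last by lia.
    have := fromC _ _ Cz zy; have := fromC _ _ Cz (chain_sym Rbs pz).
    by have := dt p z y; rewrite (dC p z); lia.
  pose Rr := chain (mono_step rest torso chiR) p.
  have rp : rest p by apply: restP.
  (* Invariant of a [true] chain: it is in [rest], or on the rim of a lost part entered from [z]. In
     the second case the bag vertices next to the rim form jumps of length at most [3 * e] from [z],
     which yield a torso edge when the chain leaves the part. *)
  suff [[_ _ /chiRP ?]|[t [z [zy [_ _ [/chiRP ? _ _] [Ut zzy yzy]]]]]] :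
    [/\ rest y, chiR y & Rr y] \/ exists t z zy, [/\ tau y = Some t, rim (below t) y,
      [/\ Rr z, rest z & chiR z] &
      [/\ U t, chain (fun a b => [/\ bag U le G t a, bag U le G t b & d a b <= 3 * e]) z zy &
      bag U le G t z /\ bag U le G t zy /\ d y zy <= e]].
  - by lia.
  - have := cover_chain dm (G_cov Ut) zzy; case: yzy => _ [_]; rewrite -/D1.
    by have := dt p z y; have := dt z zy y; rewrite (dC zy y); lia.
  elim: py => [|a b ab pa IHa]; first by left; split=> //; [rewrite -chi_rest|exact: chain0].
  have [Da Db abC gab] := ab; have [_ chia] := chip a pa.
  have redb : chi b by rewrite -abC chia.
  case: IHa => [[ra chiRa pa']|[t [z [za [at_ rima [pz rz chiRz] [Ut zza [bz [bza aza]]]]]]]].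
    case bt : (tau b) => [t|].
      have [|[_ ba _ rb]] := tau_step (DU Db) (DU Da) (Gs _ _ gab) bt.
        by have [_ -> _] := ra.
      have [[Dt _] _ _] := tau_some bt.
      right; exists t, a, a; split=> //; split; [exact: DU|exact: chain0|].
      by split=> //; split=> //; rewrite dC; exact: Re.
    have nrb : ~ rim D b.
      move=> rb; suff : ~~ chi a by rewrite chia red.
      apply: (nbr_rim b) => //; last exact: Gs.
      by move=> /rim_cl; case: ra.
    have rb : rest b by exact: restP.
    left; split=> //; first by rewrite -chi_rest.
    by apply: (chainS pa'); split=> //; [rewrite -!chi_rest|left].
  have [Lt _ at'] := tau_some at_; have [_ red_nbr _] := XP _ Lt.
  have [bt|[bN bb _ _]] := tau_step (DU Da) (DU Db) gab at_.
    have rimb : rim (below t) b.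
      apply: contrapT => nrb; have : ~~ X t b.
        apply: (red_nbr a) => //; have [_ _ bt'] := tau_some bt.
        by split=> //; exact: DU.
      by rewrite -(chi_lost _ _ bt) redb.
    have [zb bzb bzbe] := rim_below_bag Ut rimb.
    right; exists t, z, zb; split=> //; split=> //; apply: (chainS zza); split=> //.
    have := Re _ _ ab; have := dt za a zb; have := dt a b zb; rewrite (dC za a); lia.
  have nrb : ~ rim D b.
    by move=> rb; have := rim_nbr_top rb Da (Gs _ _ gab); rewrite at_.
  have rb : rest b by exact: restP.
  have chiRb : chiR b by rewrite -chi_rest.
  left; split=> //; apply: (chainS pz); split=> //; first by rewrite chiRz chiRb.
  right; split; first by exists t.
  apply: (cover_chain dm (G_cov Ut)); apply: (chainS zza); split=> //.
  by have := Re _ _ ab; have := dt za a b; rewrite (dC za a); lia.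
- by move=> <-; rewrite d0.
Qed.

End Extend.

(** Induction on the size of [below b], with the bag of [b] as [X0]. It drops for a lost [t]: if [b]
    were below [t], then [t] would itself lie in [X0]. *)
Lemma below_coloring b : U b -> exists chi, rim_coloring (below b) chi.
Proof.
have [le0 let_ lef] := le_forest; have [G0 Gs Gc] := G_cmp; have [d0 dC dt] := dm.
have [k] := ubnP #|[set u | `[<below b u>]]|.
elim: k b => // k IHk b; rewrite ltnS => bk Ub.
apply: (@extend_coloring (below b) (bag U le G b)).
- by move=> x [].
- by move=> x y [Ux xb] Uy yx; split=> //; exact: let_ xb.
- exact: G_cov.
- move=> z y Uz nbz [Uy yb] yz; split=> //; last by exists y; split=> //; exact: Gs.
  have nle : ~ le z b by move=> zb; apply: nbz; split.
  have [cmp _] := Gc _ _ Uy Uz yz.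
  have yz' : le y z by case: cmp => // zy; case: nle; exact: let_ yb.
  by have [|/nle] := lef _ _ _ yb yz'.
- move=> t [[Ut tb] far]; apply: IHk => //; apply: leq_trans bk.
  apply: proper_card; apply/properP; split.
    apply/fintype.subsetP => u; rewrite !finset.in_set => /asboolP[Uu ut]; apply/asboolP.
    by split; [exact: Uu|exact: let_ tb].
  exists b; rewrite !finset.in_set; first by apply/asboolP; split.
  apply/asboolP => -[_ bt]; apply: (far t).
    by split=> //; exists t; split.
  exists t; last by rewrite d0.
  by split=> //; exists t; split.
Qed.

Lemma tree_step_coloring : exists chi : T -> bool, mono_bounded d U G chi F.
Proof.
suff [chi []] : exists chi, rim_coloring U chi by exists chi.
apply: (@extend_coloring U (fun=> False)) => //.
- by exists (fun=> 0); split.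
- by move=> t [Ut _]; exact: below_coloring.
Qed.

End TreeStep.

Theorem tree_coloring (N e q : nat) : exists F, forall (T : finType)
    (d : T -> T -> nat) (U : T -> Prop) (le G : T -> T -> Prop),
  nat_metric d -> forest_order le -> comparability_graph d U le G e ->
  (forall v, U v -> covered d N q (bag U le G v)) ->
  exists chi : T -> bool, mono_bounded d U G chi F.
Proof.
elim: N e => [|N IHN] e.
  (* Every vertex of [U] lies in its own bag, so without classes [U] is empty. *)
  exists 0 => T d U le G [d0 _ _] [le0 _ _] [G0 _ _] cov.
  exists (fun=> true) => x y [|b c [_ Uc _ _] _]; first by rewrite d0.
  have [cl [clN _]] := cov _ Uc; suff /clN : bag U le G c c by [].
  by split=> //; exists c; split.
have [f fP] := IHN (e + N.+1 * (q + 3 * e)).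
eexists => T d U le G dm lef Gc cov.
apply: (tree_step_coloring (f := f) dm lef Gc cov) => U' G' Gc' cov'.
exact: fP Gc' cov'.
Qed.

Local Open Scope classical_set_scope.
Local Open Scope ring_scope.

(** * Convex sets of bounded aspect ratio *)

Section Norms.
Variable d : nat.
Implicit Types (x y z u v : 'rV[RR]_d) (K : set 'rV[RR]_d).

Lemma coord_le_norm x i : `|x 0 i| <= `|x|.
Proof.
rewrite /Num.norm/= mx_normrE.
exact: (le_bigmax _ (fun ij : 'I_1 * 'I_d => `|x ij.1 ij.2|) (0, i)).
Qed.

Lemma norm_le_coord x e : 0 <= e -> (forall i, `|x 0 i| <= e) -> `|x| <= e.
Proof.
move=> e0 xe; rewrite /Num.norm/= mx_normrE; apply: bigmax_le => // -[i j] _ /=.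
by rewrite (ord1 i).
Qed.

Lemma dotpBr u x y : dotp u (x - y) = dotp u x - dotp u y.
Proof. by rewrite /dotp -sumrB; apply: eq_bigr => i _; rewrite !mxE mulrBr. Qed.

Lemma dotpZl a u x : dotp (a *: u) x = a * dotp u x.
Proof. by rewrite /dotp mulr_sumr; apply: eq_bigr => i _; rewrite mxE mulrA. Qed.

Lemma dotpC u v : dotp u v = dotp v u.
Proof. by apply: eq_bigr => i _; rewrite mulrC. Qed.

Lemma dotp_ge0 u : 0 <= dotp u u.
Proof. by apply: sumr_ge0 => i _; rewrite -expr2 sqr_ge0. Qed.

Lemma coord_le_enorm x i : `|x 0 i| <= enorm x.
Proof.
rewrite -sqrtr_sqr /enorm ler_wsqrtr // /dotp (bigD1 i) //= -expr2 lerDl.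
by apply: sumr_ge0 => j _; rewrite -expr2 sqr_ge0.
Qed.

Lemma norm_le_enorm x : `|x| <= enorm x.
Proof. by apply: norm_le_coord => [|i]; [exact: sqrtr_ge0|exact: coord_le_enorm]. Qed.

Lemma enorm_le_norm x : enorm x <= d%:R * `|x|.
Proof.
have dx0 : 0 <= d%:R * `|x| by rewrite mulr_ge0 ?ler0n.
rewrite -(ger0_norm dx0) -sqrtr_sqr /enorm ler_wsqrtr // /dotp.
apply: (@le_trans _ _ (\sum_(i < d) `|x| ^+ 2)).
  apply: ler_sum => i _; rewrite -expr2 -real_normK ?num_real //.
  by rewrite lerXn2r ?nnegrE ?normr_ge0 ?coord_le_norm.
rewrite sumr_const card_ord exprMn -[leLHS]mulr_natl ler_wpM2r ?sqr_ge0 //.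
rewrite -natrX ler_nat; case: (d) => // n; by rewrite leq_pmulr.
Qed.

Lemma enorm_unit u : enorm u != 0 -> enorm ((enorm u)^-1 *: u) = 1.
Proof.
move=> u0; rewrite {1}/enorm dotpZl dotpC dotpZl mulrA -expr2.
rewrite -[X in _ * X]sqr_sqrtr ?dotp_ge0 // -/(enorm u) -exprMn mulVf //.
by rewrite expr1n sqrtr1.
Qed.

Lemma compact_norm_bounded K : compact K -> exists2 M, 0 < M & forall x, K x -> `|x| <= M.
Proof.
move=> /compact_bounded [M [_ HM]]; exists (`|M| + 1); first by rewrite ltr_wpDl.
by move=> x Kx; apply: (HM (`|M| + 1)) => //; rewrite ltr_pwDr // ler_norm.
Qed.

Lemma norm_le_diam K x y : compact K -> K x -> K y -> `|x - y| <= diam K.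
Proof.
move=> /compact_norm_bounded[M M0 KM] Kx Ky.
apply: le_trans (norm_le_enorm _) _; apply: ub_le_sup; last by exists x => //; exists y.
exists (d%:R * (M + M)) => _ [a Ka [b Kb <-]].
apply: le_trans (enorm_le_norm _) _; rewrite ler_wpM2l ?ler0n //.
by apply: le_trans (ler_normB _ _) _; rewrite lerD ?KM.
Qed.

Lemma interiorP K x : K° x <-> exists2 e, 0 < e & forall y, `|x - y| < e -> K y.
Proof.
rewrite /interior nbhs_ballP; split=> [[e /= e0 eK]|[e e0 eK]]; exists e => // y.
  by move=> xy; apply: eK; rewrite -ball_normE.
by rewrite -ball_normE => /eK.
Qed.

Lemma compact_is_closed K : compact K -> closed K.
Proof. by apply: compact_closed; exact: norm_hausdorff. Qed.

Lemma closed_eps K x : closed K -> (forall e, 0 < e -> exists2 y, K y & `|x - y| < e) -> K x.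
Proof.
move=> clK xK; apply: clK => B /nbhs_ballP[e /= e0 eB].
have [y Ky xy] := xK e e0; exists y; split => //; apply: eB.
by rewrite -ball_normE.
Qed.

End Norms.

(** * Balls inscribed in convex sets that are wide in every direction *)

Section Inradius.
Variables (d : nat) (K : set 'rV[RR]_d) (x0 : 'rV[RR]_d) (eta : RR).
Hypotheses (Kcpt : compact K) (Kcvx : Defs.convex_set K) (Kx0 : K x0) (eta0 : 0 < eta).
Hypothesis wide : forall u, enorm u = 1 -> exists2 x, K x & eta < `|dotp u (x - x0)|.

Lemma wide_nz u : u != 0 -> exists2 x, K x & dotp u (x - x0) != 0.
Proof.
move=> u0; have nu0 : enorm u != 0.
  apply: contra u0 => /eqP nu; rewrite -normr_le0 -[leRHS]nu; exact: norm_le_enorm.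
have [x Kx xu] := wide (enorm_unit nu0); exists x => //.
by apply: contraTneq xu => ux; rewrite dotpZl ux mulr0 normr0 -leNgt ltW.
Qed.

(** A point [x] of [K] with [x - x0] not orthogonal to some [w] in the orthogonal complement of the
    rows found so far gives a new independent row. *)
Lemma wide_row_free k : (k <= d)%N -> exists V : 'M[RR]_(k, d),
  row_free V /\ forall i, K (x0 + row i V).
Proof.
elim: k => [_|k IHk kd].
  by exists 0; split; [rewrite /row_free mxrank0|case].
have [V [Vfree VK]] := IHk (ltnW kd).
have [w w0 wV] : exists2 w : 'rV[RR]_d, w != 0 & w *m V^T = 0.
  have : kermx V^T != 0.
    rewrite -mxrank_eq0 mxrank_ker mxrank_tr subn_eq0 -ltnNge.
    by move: Vfree; rewrite /row_free => /eqP ->.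
  case/rowV0Pn => w wker w0; exists w => //; exact/sub_kermxP.
have [x Kx wx] := wide_nz w0.
exists (col_mx (x - x0) V : 'M[RR]_(1 + k, d)); split; last first.
  move=> i; case: (@split_ordP 1 k i) => j ->.
    rewrite (_ : row _ _ = x - x0) ?subrKC //.
    by rewrite -[RHS](row_id j); exact: (@rowKu _ 1 k).
  by rewrite (_ : row _ _ = row j V) //; exact: (@rowKd _ 1 k).
apply: (@inj_row_free _ (1 + k)) => y; rewrite -[y]hsubmxK mul_row_col.
set y1 := lsubmx y; set y2 := rsubmx y => y0.
have y10 : y1 = 0.
  have : y1 *m (x - x0) *m w^T + y2 *m V *m w^T = 0 by rewrite -mulmxDl y0 mul0mx.
  rewrite -[y2 *m V *m _]mulmxA -[V]trmxK -trmx_mul wV trmx0 mulmx0 addr0 => /matrixP /(_ 0 0).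
  rewrite -mulmxA [y1]mx11_scalar mul_scalar_mx !mxE => /eqP; rewrite mulf_eq0.
  case/orP => /eqP; first by move=> ->; rewrite raddf0.
  move=> wx'; case/eqP: wx; rewrite -[RHS]wx'.
  by apply: eq_bigr => j _; rewrite !mxE mulrC.
rewrite y10 mul0mx add0r in y0; rewrite y10 (_ : y2 = 0) ?row_mx0 //.
by apply: (row_free_inj Vfree); rewrite y0 mul0mx.
Qed.

Definition spanned_dets : set RR :=
  [set `|\det V| | V in [set V : 'M[RR]_d | forall i, K (x0 + row i V)]].

Lemma spanned_dets_bounded : has_ubound spanned_dets.
Proof.
have [M M0 KM] := compact_norm_bounded Kcpt.
exists (\sum_(s : 'S_d) \prod_(i < d) (M + M)) => _ [V VK <-].
apply: le_trans (ler_norm_sum _ _ _) _; apply: ler_sum => s _.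
rewrite normrM normrX normrN1 expr1n mul1r normr_prod; apply: ler_prod => i _.
rewrite normr_ge0 /=; have -> : V i (s i) = (row i V) 0 (s i) by rewrite mxE.
apply: le_trans (coord_le_norm _ _) _.
rewrite -[row i V](addKr x0); apply: le_trans (ler_normD _ _) _.
by rewrite normrN lerD // KM.
Qed.

(* By Cramer's rule, rows of nearly maximal determinant have all of [K - x0] in
   the parallelepiped with coordinates in [[-2, 2]]. *)
Lemma exists_large_basis : exists2 V : 'M[RR]_d,
  V \in unitmx /\ (forall i, K (x0 + row i V)) &
  forall x k, K x -> `|((x - x0) *m invmx V) 0 k| <= 2.
Proof.
have [V0 [V0free V0K]] := wide_row_free (leqnn d).
have V0D : spanned_dets `|\det V0| by exists V0.
have V0det : 0 < `|\det V0|.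
  by rewrite normr_gt0 -unitfE -unitmxE -row_free_unit.
set s := sup spanned_dets.
have s0 : 0 < s by apply: lt_le_trans V0det _; exact: (ub_le_sup spanned_dets_bounded).
have [|_ [V VK <-] sV] := @sup_adherent _ spanned_dets (s / 2) _
  (conj (ex_intro _ _ V0D) spanned_dets_bounded); first by rewrite divr_gt0.
have {}sV : s / 2 < `|\det V| by move: sV; rewrite -/s; lra.
have Vdet : \det V != 0 by rewrite -normr_gt0; lra.
have Vu : V \in unitmx by rewrite unitmxE unitfE.
exists V => // x k Kx.
pose Vk := \matrix_(i, j) (if i == k then (x - x0) 0 j else V i j).
have Vks : `|\det Vk| <= s.
  apply: (ub_le_sup spanned_dets_bounded); exists Vk => // i /=.
  case: (eqVneq i k) => [->|ik].
    by rewrite (_ : row k Vk = x - x0) ?subrKC //; apply/rowP => j; rewrite !mxE eqxx.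
  rewrite (_ : row i Vk = row i V) //; apply/rowP => j; rewrite !mxE.
  by rewrite (negbTE ik).
have -> : ((x - x0) *m invmx V) 0 k = (\det V)^-1 * \det Vk.
  rewrite (expand_det_row Vk k) mulr_sumr mxE; apply: eq_bigr => j _.
  rewrite /invmx Vu !mxE eqxx mulrCA; congr (_ * (_ * _)).
  rewrite /cofactor; congr (_ * \det _); apply/matrixP => a b; rewrite !mxE.
  by rewrite eq_sym (negbTE (neq_lift _ _)).
rewrite normrM normfV ler_pdivrMl ?normr_gt0 //; lra.
Qed.

Lemma convex_comb x y t : K x -> K y -> 0 <= t -> t <= 1 -> K ((1 - t) *: x + t *: y).
Proof. by move=> Kx Ky t0 t1; apply: (@Kcvx x y t Kx Ky); rewrite t0. Qed.

Lemma convex_sum (v : 'I_d -> 'rV[RR]_d) (a : 'I_d -> RR) :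
  (forall k, K (x0 + v k)) -> (forall k, 0 <= a k) -> \sum_k a k <= 1 ->
  K (x0 + \sum_k a k *: v k).
Proof.
move=> vK a0 a1.
suff [w Kw ->] : exists2 w, K (x0 + w) & \sum_k a k *: v k = (\sum_k a k) *: w.
  have -> : x0 + (\sum_k a k) *: w = (1 - \sum_k a k) *: x0 + (\sum_k a k) *: (x0 + w).
    by rewrite scalerDr addrA -scalerDl subrK scale1r.
  by apply: convex_comb => //; exact: sumr_ge0.
elim: (index_enum _) => [|k r [w Kw IHr]].
  by exists 0; rewrite ?addr0 // !big_nil scale0r.
rewrite !big_cons IHr; set S := \sum_(_ <- _) _.
have S0 : 0 <= S by exact: sumr_ge0.
have [aS|aS] := eqVneq (a k + S) 0.
  exists w => //; rewrite aS scale0r.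
  have -> : a k = 0 by have := a0 k; lra.
  by have -> : S = 0 by [have := a0 k; lra]; rewrite !scale0r addr0.
have aS0 : 0 < a k + S by rewrite lt_def aS addr_ge0.
exists ((1 - S / (a k + S)) *: v k + (S / (a k + S)) *: w); last first.
  rewrite scalerDr !scalerA mulrBr mulr1 mulrCA divff // mulr1.
  by rewrite (addrK S (a k)).
have -> : x0 + ((1 - S / (a k + S)) *: v k + (S / (a k + S)) *: w) =
    (1 - S / (a k + S)) *: (x0 + v k) + (S / (a k + S)) *: (x0 + w).
  by rewrite !scalerDr addrACA -scalerDl subrK scale1r.
apply: convex_comb => //; first by rewrite divr_ge0 // ltW.
by rewrite ler_pdivrMr // mul1r lerDr.
Qed.

(** The centre gives weight [1 / (d + 1)] to each row of a large basis. Within the radius each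
    weight changes by at most [1 / (d * (d + 1))], so the weights stay nonnegative with sum at most
    1. *)
Lemma wide_ball : (0 < d)%N ->
  exists q, forall z, `|z - q| <= eta / (2 * d%:R ^+ 2 * (d%:R + 1)) -> K z.
Proof.
move=> d0; have [V [Vu VK] Vbig] := exists_large_basis.
have dR : 0 < d%:R :> RR by rewrite ltr0n.
have d1 : 0 < d%:R + 1 :> RR by rewrite addr_gt0.
(* The column [f] of the inverse reads off a coordinate, at most 2 in absolute value on [K - x0],
   while [K] extends by more than [eta] along [f]; so [f] has norm at most [2 / eta]. *)
have finv i k : `|invmx V i k| <= 2 / eta.
  pose f := (col k (invmx V))^T.
  have fE z : dotp f z = (z *m invmx V) 0 k.
    by rewrite mxE; apply: eq_bigr => j _; rewrite !mxE mulrC.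
  have -> : invmx V i k = f 0 i by rewrite !mxE.
  apply: le_trans (coord_le_enorm _ _) _.
  have [->|nf] := eqVneq (enorm f) 0; first by rewrite divr_ge0 // ltW.
  have f0 : 0 < enorm f by rewrite lt_def nf sqrtr_ge0.
  have [x Kx] := wide (enorm_unit nf); rewrite dotpZl fE normrM normfV (gtr0_norm f0).
  rewrite ltr_pdivlMl // => /ltW xe; rewrite ler_pdivlMr //.
  exact: le_trans xe (Vbig x k Kx).
exists (x0 + \sum_k (d%:R + 1)^-1 *: row k V) => z zq.
pose y := z - (x0 + \sum_k (d%:R + 1)^-1 *: row k V).
pose a k := (d%:R + 1)^-1 + (y *m invmx V) 0 k.
have yb k : `|(y *m invmx V) 0 k| <= (d%:R * (d%:R + 1))^-1.
  rewrite mxE; apply: le_trans (ler_norm_sum _ _ _) _.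
  have -> : (d%:R * (d%:R + 1))^-1 =
      \sum_(i < d) (eta / (2 * d%:R ^+ 2 * (d%:R + 1)) * (2 / eta)) :> RR.
    rewrite sumr_const card_ord -[RHS]mulr_natl; field; by rewrite !gt_eqF.
  apply: ler_sum => i _; rewrite normrM ler_pM //.
  exact: le_trans (coord_le_norm _ _) zq.
have -> : z = x0 + \sum_k a k *: row k V.
  have -> : \sum_k a k *: row k V =
      \sum_k (d%:R + 1)^-1 *: row k V + y *m invmx V *m V.
    rewrite mulmx_sum_row -big_split; apply: eq_bigr => k _ /=.
    by rewrite scalerDl.
  by rewrite mulmxKV // addrA /y addrC subrK.
have dd : (d%:R * (d%:R + 1))^-1 <= (d%:R + 1)^-1 :> RR.
  rewrite invfM ler_piMl ?invr_ge0 ?(ltW d1) // invf_le1 // ler1n //.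
apply: convex_sum => // [k|].
  rewrite /a; have := yb k; rewrite ler_norml => /andP[]; lra.
have ab k : a k <= (d%:R + 1)^-1 + (d%:R * (d%:R + 1))^-1.
  by rewrite lerD2l (le_trans (ler_norm _)).
apply: le_trans (ler_sum _ (fun k _ => ab k)) _.
rewrite sumr_const card_ord -[leLHS]mulr_natl le_eqVlt; apply/orP; left; apply/eqP.
by field; rewrite !gt_eqF.
Qed.

End Inradius.

Lemma fat_ball (d : nat) (alpha : RR) : (0 < d)%N -> 1 <= alpha ->
  exists2 c : RR, 0 < c & forall K : set 'rV[RR]_d,
    compact K -> Defs.convex_set K -> aspect_ratio_le K alpha -> 0 < diam K ->
    exists q, forall z, `|z - q| <= c * diam K -> K z.
Proof.
move=> d0 al1; have al0 : 0 < alpha by lra.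
pose c0 : RR := 2 * d%:R ^+ 2 * (d%:R + 1).
have c00 : 0 < c0 by rewrite !mulr_gt0 ?exprn_gt0 ?addr_gt0 ?ltr0n.
exists (4 * alpha * c0)^-1; first by rewrite invr_gt0 mulr_gt0 // mulr_gt0.
move=> K Kcpt Kcvx Kasp K0.
have [x0 Kx0] : exists x0, K x0.
  apply: contrapT => nK; move: K0; rewrite /diam (_ : [set _ | _ in _ & _ in _] = set0).
    by rewrite sup0 ltxx.
  by apply/seteqP; split=> // z [x Kx _]; case: nK; exists x.
have h0 : 0 < height K.
  by rewrite -(pmulr_rgt0 _ al0); exact: lt_le_trans K0 Kasp.
(* Otherwise a slab of width [height K / 2] would contain [K]. *)
have wide u : enorm u = 1 -> exists2 x, K x & height K / 4 < `|dotp u (x - x0)|.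
  move=> u1; apply: contrapT => nx.
  have : height K <= height K / 2.
    apply: ge_inf; first by exists 0 => h [].
    split; first by rewrite divr_ge0 // ltW.
    exists u, (dotp u x0 - height K / 4); split => // x Kx.
    have : `|dotp u (x - x0)| <= height K / 4.
      by rewrite leNgt; apply/negP => ?; apply: nx; exists x.
    rewrite dotpBr ler_norml => /andP[? ?]; lra.
  lra.
have h4 : 0 < height K / 4 by rewrite divr_gt0.
have [q qK] := wide_ball Kcpt Kcvx Kx0 h4 wide d0.
exists q => z zq; apply: qK; apply: le_trans zq _.
rewrite -/c0 ler_pdivlMr // [X in X <= _](_ : _ = diam K / (4 * alpha)).
  rewrite ler_pdivrMr ?mulr_gt0 // (_ : _ * (4 * alpha) = alpha * height K) //; by field.
by field; rewrite !gt_eqF.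
Qed.

(** The homothety with centre [z] and ratio [s / t] maps [K] into itself and shrinks the given ball
    to the required one. *)
Lemma fat_ball_near (d : nat) (K : set 'rV[RR]_d) (c t s : RR) (q z : 'rV[RR]_d) :
  Defs.convex_set K -> 0 < c -> 0 < s -> s <= t ->
  (forall x y, K x -> K y -> `|x - y| <= t) ->
  (forall y, `|y - q| <= c * t -> K y) -> K z ->
  exists2 p, `|p - z| <= s & forall y, `|y - p| <= c * s -> K y.
Proof.
move=> Kcvx c0 s0 st Kt qK Kz; have t0 : 0 < t by exact: lt_le_trans st.
pose r := s / t.
have r0 : 0 < r by rewrite divr_gt0.
have r1 : r <= 1 by rewrite ler_pdivrMr // mul1r.
have Kq : K q by apply: qK; rewrite subrr normr0 mulr_ge0 // ltW.
exists ((1 - r) *: z + r *: q).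
  have -> : (1 - r) *: z + r *: q - z = r *: (q - z).
    by rewrite scalerBl scale1r scalerBr addrAC [z - _]addrC addrK addrC.
  rewrite normrZ gtr0_norm // /r -[leRHS](divfK (lt0r_neq0 t0)).
  by rewrite ler_wpM2l ?(ltW r0) // Kt.
move=> y yp.
pose q' := q + r^-1 *: (y - ((1 - r) *: z + r *: q)).
have -> : y = (1 - r) *: z + r *: q'.
  by rewrite scalerDr scalerA divff ?gt_eqF // scale1r addrA subrKC.
apply: convex_comb => //; last exact: ltW.
apply: qK; rewrite addrC addKr normrZ normfV gtr0_norm // ler_pdivrMl //.
by apply: le_trans yp _; rewrite mulrCA /r divfK ?gt_eqF.
Qed.

Lemma ray_exit (d : nat) (K : set 'rV[RR]_d) (u x : 'rV[RR]_d) :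
  compact K -> u != 0 -> K x ->
  exists2 t, 0 <= t & K (x + t *: u) /\ ~ K° (x + t *: u).
Proof.
move=> Kcpt u0 Kx; have nu0 : 0 < `|u| by rewrite normr_gt0.
have [M M0 KM] := compact_norm_bounded Kcpt.
pose A := [set t : RR | 0 <= t /\ K (x + t *: u)].
have A0 : A 0 by split; rewrite ?scale0r ?addr0.
have Aub : has_ubound A.
  exists ((M + M) / `|u|) => t [t0 Kt]; rewrite ler_pdivlMr //.
  rewrite -[t](ger0_norm t0) -normrZ -[_ *: _](addKr x).
  by apply: le_trans (ler_normD _ _) _; rewrite normrN lerD ?KM.
have supA : has_sup A by split => //; exists 0.
have t0 : 0 <= sup A by exact: (ub_le_sup Aub).
exists (sup A) => //; split.
  apply: closed_eps; first exact: compact_is_closed.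
  move=> e e0; have eu : 0 < e / `|u| by rewrite divr_gt0.
  have [t At st] := sup_adherent eu supA; exists (x + t *: u); first by case: At.
  rewrite opprD addrACA subrr add0r -scalerBl normrZ -ltr_pdivlMr //.
  have ts : t <= sup A by exact: (ub_le_sup Aub).
  by rewrite ger0_norm ?subr_ge0 //; lra.
move=> /interiorP[e e0 eK].
have eu : 0 < e / `|u| / 2 by rewrite !divr_gt0.
have : A (sup A + e / `|u| / 2).
  split; first by rewrite addr_ge0 // ltW.
  apply: eK; rewrite scalerDl addrA opprD addrA subrr sub0r normrN normrZ gtr0_norm //.
  by rewrite mulrAC divfK ?gt_eqF //; lra.
by move=> /(ub_le_sup Aub); lra.
Qed.

(** On a path in [S], lying in [K] and lying in its interior agree, so the condition is both open
    and closed along the path. *)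
Lemma path_connected_interior (d : nat) (S K : set 'rV[RR]_d) (x y : 'rV[RR]_d) :
  path_connected S -> closed K -> (forall z, S z -> K z -> K° z) ->
  S x -> K° x -> S y -> K° y.
Proof.
move=> Spc Kcl SK Sx Kx Sy; have [f [fc [f0 [f1 fS]]]] := Spc _ _ Sx Sy.
have If := connected_continuous_connected (@segment_connected _ 0 1) fc.
set I := f @` _ in If.
have I1 t : 0 <= t <= 1 -> I (f t).
  by move=> t01; exists t => //=; rewrite in_itv.
have If0 : I x by rewrite -f0; apply: I1; rewrite lexx ler01.
have If1 : I y by rewrite -f1; apply: I1; rewrite lexx ler01.
suff IK : I `&` K° = I by move: If1; rewrite -IK => -[].
apply: If; first by exists x.
- by exists K° => //; exact: open_interior.
- exists K => //; apply/seteqP; split=> z [Iz Kz]; split=> //; first exact: interior_subset Kz.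
  by apply: SK => //; case: Iz => t /=; rewrite in_itv /= => t01 <-; exact: fS.
Qed.

(** * Intersection graphs of sets with holes *)

Section Walks.
Variables (T : Type) (adj : T -> T -> Prop).

Lemma walk_cat a b x y z : walk adj a x y -> walk adj b y z -> walk adj (a + b) x z.
Proof.
elim: a x => [x -> //|a IHa x [x' [xx' x'y]] yz].
by rewrite addSn; exists x'; split => //; exact: IHa.
Qed.

Lemma walk_rev a x y : (forall u v, adj u v -> adj v u) ->
  walk adj a x y -> walk adj a y x.
Proof.
move=> adjC; elim: a x => [x -> //|a IHa x [x' [xx' /IHa x'y]]].
by rewrite -addn1; apply: (walk_cat x'y); exists x; split => //; exact: adjC.
Qed.

Lemma graph_distance : graph_connected adj -> exists dist : T -> T -> nat,
  (forall x y, walk adj (dist x y) x y) /\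
  (forall k x y, walk adj k x y -> (dist x y <= k)%N).
Proof.
move=> conn.
have W x y : exists k, `[< walk adj k x y >].
  by have [k w] := conn x y; exists k; exact/asboolP.
exists (fun x y => ex_minn (W x y)); split=> [x y|k x y w].
  by case: ex_minnP => k /asboolP.
by case: ex_minnP => n _; apply; exact/asboolP.
Qed.

End Walks.

(* The part of the geometry that is used: [K i] is the convex hull of [S i] and
   [t i] plays the role of its diameter. *)
Record fat_system (d : nat) (c : RR) (T : finType) (K S : T -> set 'rV[RR]_d)
    (t : T -> RR) (adj : T -> T -> Prop) (dist : T -> T -> nat) : Prop := FatSystem {
  sys_compact : forall i, compact (K i);
  sys_convex : forall i, Defs.convex_set (K i);
  sys_path : forall i, path_connected (S i);
  sys_sub : forall i, S i `<=` K i;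
  sys_boundary : forall i x, K i x -> ~ (K i)° x -> S i x;
  sys_size_ge0 : forall i, 0 <= t i;
  sys_size : forall i x y, K i x -> K i y -> `|x - y| <= t i;
  sys_fat : forall i, 0 < t i -> exists q, forall z, `|z - q| <= c * t i -> K i z;
  sys_adj : forall i j, adj i j <-> i <> j /\ S i `&` S j !=set0;
  sys_walk : forall i j, walk adj (dist i j) i j;
  sys_dist : forall k i j, walk adj k i j -> (dist i j <= k)%N }.

(* [v] lies in a hole of [w]. *)
Definition inside (d : nat) (T : Type) (K S : T -> set 'rV[RR]_d) (v w : T) :=
  S v `&` (K w)° !=set0 /\ ~ (S v `&` S w !=set0).

Section System.
Variables (d : nat) (c : RR) (T : finType) (K S : T -> set 'rV[RR]_d).
Variables (t : T -> RR) (adj : T -> T -> Prop) (dist : T -> T -> nat).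
Hypothesis sys : fat_system c K S t adj dist.

Let ins := inside K S.
Let kcpt i : compact (K i). Proof. exact: (sys_compact sys). Qed.
Let kcvx i : Defs.convex_set (K i). Proof. exact: (sys_convex sys). Qed.

Lemma adjC u v : adj u v -> adj v u.
Proof.
move=> /(sys_adj sys)[uv [x [Su Sv]]]; apply/(sys_adj sys).
by split; [exact: nesym|exists x].
Qed.

Lemma dist_metric : nat_metric dist.
Proof.
split=> [x|x y|x y z].
- by apply/eqP; rewrite -leqn0; apply: (sys_dist sys).
- by apply/eqP; rewrite eqn_leq; apply/andP; split; apply: (sys_dist sys);
    apply: walk_rev (sys_walk sys _ _); exact: adjC.
- exact: (sys_dist sys (walk_cat (sys_walk sys _ _) (sys_walk sys _ _))).
Qed.

Lemma adj_dist u v : adj u v -> (dist u v <= 1)%N.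
Proof. by move=> uv; apply: (sys_dist sys); exists v. Qed.

Lemma meet_dist u v : S u `&` S v !=set0 -> (dist u v <= 1)%N.
Proof.
move=> uv; have [->|nuv] := pselect (u = v).
  by have [-> _ _] := dist_metric.
by apply: adj_dist; apply/(sys_adj sys).
Qed.

Lemma dist_le1 u v : (dist u v <= 1)%N -> u = v \/ adj u v.
Proof.
have := sys_walk sys u v; case: (dist u v) => [|[|//]]; first by left.
by move=> [z [uz <-]] _; right.
Qed.

Lemma inside_sub v w x : ins v w -> S v x -> (K w)° x.
Proof.
move=> [[y [Svy Kwy]] nvw] Svx.
have Spc : path_connected (S v) by exact: (sys_path sys).
apply: (path_connected_interior Spc _ _ Svy Kwy Svx).
  by apply: compact_is_closed; exact: (sys_compact sys).
move=> z Svz Kwz; apply: contrapT => nKwz; apply: nvw; exists z; split => //.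
exact: (sys_boundary sys Kwz nKwz).
Qed.

Lemma inside_not_adj v w : ins v w -> ~ adj v w.
Proof. by move=> [_ nvw] /(sys_adj sys)[]. Qed.

Lemma inside_step v v' w : ins v w -> adj v v' -> v' <> w -> ~ adj v' w -> ins v' w.
Proof.
move=> vw /(sys_adj sys)[_ [x [Sv Sv']]] v'w nadj; split.
  by exists x; split => //; exact: inside_sub vw Sv.
by move=> v'w'; apply: nadj; apply/(sys_adj sys).
Qed.

(** A ray from the common point leaves one hull no later than the other. The exit point is on the
    boundary of the first hull, hence in its set, and still in the other hull. *)
Lemma meet_or_inside i j x : (0 < d)%N -> K i x -> K j x ->
  ~ (S i `&` S j !=set0) -> ins i j \/ ins j i.
Proof.
move=> d0 Kix Kjx nij.
wlog : i j Kix Kjx nij / exists2 y, S i y & K j y.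
  pose u : 'rV[RR]_d := const_mx 1.
  have u0 : u != 0.
    by apply/eqP => /rowP/(_ (Ordinal d0)); rewrite !mxE => /eqP; rewrite oner_eq0.
  have [a a0 [Ka nKa]] := ray_exit (@kcpt i) u0 Kix.
  have [b b0 [Kb nKb]] := ray_exit (@kcpt j) u0 Kjx.
  have seg e f k : 0 <= e -> e <= f -> K k x -> K k (x + f *: u) -> K k (x + e *: u).
    move=> e0 ef Kx Kf; have [f0|f0] := eqVneq f 0.
      by rewrite (_ : e = 0) ?scale0r ?addr0 //; lra.
    have fp : 0 < f by rewrite lt_def f0 (le_trans e0).
    have -> : x + e *: u = (1 - e / f) *: x + (e / f) *: (x + f *: u).
      by rewrite scalerDr addrA -scalerDl subrK scale1r scalerA divfK.
    apply: (convex_comb (@kcvx k)) => //; first by rewrite divr_ge0 // ltW.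
    by rewrite ler_pdivrMr // mul1r.
  have [ab|ba] := leP a b => key.
    apply: key => //; exists (x + a *: u); first exact: (sys_boundary sys Ka nKa).
    exact: seg ab Kjx Kb.
  have [||||//|] := key j i => //.
  - by move=> [y [Sj Si]]; apply: nij; exists y.
  - exists (x + b *: u); first exact: (sys_boundary sys Kb nKb).
    exact: seg (ltW ba) Kix Ka.
  - by right.
  - by left.
move=> [y Siy Kjy]; left; split => //; exists y; split => //.
apply: contrapT => nKjy; apply: nij; exists y; split => //.
exact: (sys_boundary sys Kjy nKjy).
Qed.

(** A hull reaching farthest in the first coordinate does so at a boundary point, which belongs to
    its set; a hull with this point in its interior would reach farther. *)
Lemma outermost (v : T) : (0 < d)%N -> exists v0, forall w, ~ ins v0 w.
Proof.
move=> d0; pose i0 := Ordinal d0.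
have [[v1 [x1 Kx1]]|allempty] := pselect (exists v1, K v1 !=set0); last first.
  exists v => w [[x [Svx _]] _]; apply: allempty; exists v, x.
  exact: (sys_sub sys Svx).
have /choice[p pP] : forall v, exists p : 'rV[RR]_d, K v !=set0 ->
    K v p /\ forall x, K v x -> x 0 i0 <= p 0 i0.
  move=> v'; have [ne|] := pselect (K v' !=set0); last by exists 0.
  have [|p] := @EVT_max_rV _ _ (fun x : 'rV[RR]_d => x 0 i0) _ ne (@kcpt v').
    by apply: continuous_subspaceT; exact: coord_continuous.
  rewrite inE => Kp pmax; exists p => _; split => // x Kx.
  by apply: pmax; rewrite inE.
have ne1 : (fun v => `[< K v !=set0 >]) v1 by apply/asboolP; exists x1.
case: (@arg_maxP _ _ _ v1 (fun v => `[< K v !=set0 >]) (fun v => p v 0 i0) ne1) => v0 /asboolP ne0 v0max.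
exists v0 => w v0w; have [Kp pmax] := pP _ ne0.
have Sp : S v0 (p v0).
  apply: (sys_boundary sys Kp) => /interiorP[e e0 eK].
  have : K v0 (p v0 + (e / 2) *: const_mx 1).
    apply: eK; rewrite opprD addrA subrr sub0r normrN normrZ gtr0_norm ?divr_gt0 //.
    have : `|const_mx 1 : 'rV[RR]_d| <= 1.
      by apply: norm_le_coord => // i; rewrite mxE normr1.
    move=> n1; apply: (@le_lt_trans _ _ (e / 2)); last by lra.
    by rewrite ler_piMr // divr_ge0 // ltW.
  by move=> /pmax; rewrite !mxE; lra.
have /interiorP[e e0 eK] := inside_sub v0w Sp.
have Kq : K w (p v0 + (e / 2) *: const_mx 1).
  apply: eK; rewrite opprD addrA subrr sub0r normrN normrZ gtr0_norm ?divr_gt0 //.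
  have : `|const_mx 1 : 'rV[RR]_d| <= 1.
    by apply: norm_le_coord => // i; rewrite mxE normr1.
  move=> n1; apply: (@le_lt_trans _ _ (e / 2)); last by lra.
  by rewrite ler_piMr // divr_ge0 // ltW.
have new : K w !=set0 by eexists; exact: Kq.
have [_ wmax] := pP _ new.
have pw : p w 0 i0 <= p v0 0 i0 by apply: v0max; exact/asboolP.
have := wmax _ Kq; rewrite !mxE; lra.
Qed.

Section Layers.
Variable v0 : T.
Hypothesis v0_out : forall w, ~ ins v0 w.
Let l v := dist v0 v.

Lemma layer_parent v : v <> v0 -> exists v1, adj v v1 /\ l v = (l v1).+1.
Proof.
have [dd dC dt] := dist_metric; move=> vv0.
rewrite /l (dC v0); have := sys_walk sys v v0; case E : (dist v v0) => [|k] => [//|].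
move=> [v1 [vv1 w]]; exists v1; split => //.
have := sys_dist sys w; have := dt v v1 v0; have := adj_dist vv1; rewrite (dC v0 v1) E; lia.
Qed.

(* The shortest path from [v] to the outermost vertex [v0] has to cross [w]. *)
Lemma inside_layer v w : ins v w -> (l w <= l v /\ dist v w + l w <= l v + 2)%N.
Proof.
have [dd dC dt] := dist_metric.
have [n] := ubnP (l v); elim: n v => // n IHn v lvn vw.
have [v1 [vv1 lv]] : exists v1, adj v v1 /\ l v = (l v1).+1.
  by apply: layer_parent => v_v0; apply: (v0_out (w := w)); rewrite -v_v0.
have v1w : v1 <> w by move=> v1w; apply: (inside_not_adj vw); rewrite -v1w.
have dv1 := adj_dist vv1.
have [adj1|nadj1] := pselect (adj v1 w).
  by have := adj_dist adj1; have := dt v v1 w; have := dt v0 v1 w; rewrite -/(l w) -/(l v1); lia.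
have [||l1 d1] := IHn v1; [by lia|exact: inside_step vv1 v1w nadj1|].
by have := dt v v1 w; lia.
Qed.

(** Leaving a hole of [w] requires reaching [w] or a neighbour of it, at layer at most [l w + 1]; a
    walk of [k] steps from [v] does not get that low. *)
Lemma inside_stay k v v' w : walk adj k v v' -> ins v w ->
  (l w + k + 1 < l v)%N -> ins v' w.
Proof.
have [dd dC dt] := dist_metric.
elim: k v => [v <- //|k IHk v [z [vz zv']] vw lk].
have lz : (l v <= l z + 1)%N.
  by have := adj_dist vz; have := dt v0 z v; rewrite -/(l v) -/(l z) (dC z); lia.
apply: IHk zv' _ _; last by lia.
apply: inside_step vw vz _ _ => [zw|zw]; first by rewrite zw in lz; lia.
by have := adj_dist zw; have := dt v0 w z; rewrite -/(l w) -/(l z) (dC w); lia.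
Qed.

End Layers.

(** A set of size 0 has at most one point, so all sets meeting it share that point. *)
Lemma positive_near i v : 0 < t i -> exists2 w, (dist v w <= 1)%N & 0 < t w.
Proof.
have [dd dC dt] := dist_metric; move=> ti.
have : exists k, walk adj k v i by exists (dist v i); exact: (sys_walk sys).
move=> [k]; elim: k v => [v ->|k IHk v [z [vz zi]]]; first by exists i => //; rewrite dd.
have [w zw tw] := IHk _ zi.
have [tz|tz] := ltP 0 (t z); first by exists z => //; exact: adj_dist.
have [zw'|/(sys_adj sys)[_ [x [Szx Swx]]]] := dist_le1 zw; first by move: tz; rewrite zw' leNgt tw.
exists w => //; apply: meet_dist; have [_ [y [Svy Szy]]] := (sys_adj sys v z).1 vz.
exists y; split => //; suff -> : y = x by [].
apply/eqP; rewrite -subr_eq0 -normr_le0; apply: le_trans tz.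
by apply: (sys_size sys); exact: (sys_sub sys).
Qed.

Lemma sys_nonempty i v : 0 < c -> 0 < t i -> K v !=set0.
Proof.
move=> c0 ti; have [w /dist_le1[<-|vw] tw] := positive_near v ti.
  have [q qK] := sys_fat sys tw; exists q; apply: qK.
  by rewrite subrr normr0 mulr_ge0 // ltW.
have [_ [x [Svx _]]] := (sys_adj sys v w).1 vw.
by exists x; exact: (sys_sub sys Svx).
Qed.

Lemma walk_displacement k u v x y (b : RR) : walk adj k u v -> K u x -> K v y ->
  (forall z, (dist u z <= k)%N -> t z <= b) -> `|x - y| <= k.+1%:R * b.
Proof.
have [dd dC dt] := dist_metric.
elim: k u x => [u x <- Kx Ky tb|k IHk u x [z [uz zv]] Kx Ky tb].
  by rewrite mul1r; apply: le_trans (sys_size sys Kx Ky) _; apply: tb; rewrite dd.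
have [_ [p [Sup Szp]]] := (sys_adj sys u z).1 uz.
have pz := sys_sub sys Szp; have pu := sys_sub sys Sup.
rewrite -[x - y](subrKA p); apply: le_trans (ler_normD _ _) _.
rewrite -[k.+2]add1n natrD mulrDl mul1r lerD //.
  by apply: le_trans (sys_size sys Kx pu) _; apply: tb; rewrite dd.
apply: (IHk z) => // z' zz'; apply: tb.
by have := adj_dist uz; have := dt u z z'; lia.
Qed.

Lemma walk_first_big k y w x (s : RR) : s <= t w -> 0 <= s -> walk adj k y w -> K y x ->
  exists z p, [/\ s <= t z, K z p, `|x - p| <= k%:R * s & (dist y z <= k)%N].
Proof.
have [dd dC dt] := dist_metric; move=> sw s0.
elim: k y x => [y x yw Kx|k IHk y x [y1 [yy1 w1]] Kx].
  by rewrite -yw in sw; exists y, x; split => //; rewrite ?subrr ?normr0 ?mul0r ?dd.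
have [sy|sy] := leP s (t y).
  by exists y, x; split => //; rewrite ?subrr ?normr0 ?dd // mulr_ge0.
have [_ [p1 [Syp Sy1p]]] := (sys_adj sys y y1).1 yy1.
have [z [p [sz Kp xp yz]]] := IHk y1 p1 w1 (sys_sub sys Sy1p).
exists z, p; split => //; last by have := adj_dist yy1; have := dt y y1 z; lia.
rewrite -[x - p](subrKA p1); apply: le_trans (ler_normD _ _) _.
rewrite -[k.+1%:R]natr1 mulrDl mul1r addrC lerD //.
exact: le_trans (sys_size sys Kx (sys_sub sys Syp)) (ltW sy).
Qed.

End System.

(** * Grids and packing *)

(* The grid of mesh [s] shifted by [j / n] of the mesh. As [n.+1 = 1] modulo [n],
   the grid of mesh [s * n.+1] with the same [j] is coarser. *)
Definition cell (n j : nat) (s a : RR) : int := Num.floor (a / s - j%:R / n%:R).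

Definition deep (n j : nat) (s a : RR) :=
  forall b, `|b - a| <= s / (4 * n%:R) -> cell n j s b = cell n j s a.

Section Grid.
Variable n : nat.
Hypothesis n0 : (0 < n)%N.

Lemma cell_coarser j s a b : 0 < s ->
  cell n j s a = cell n j s b -> cell n j (s * n.+1%:R) a = cell n j (s * n.+1%:R) b.
Proof.
have nR : n%:R != 0 :> RR by rewrite pnatr_eq0 -lt0n.
move=> s0; rewrite /cell.
(* As [(j / n + j) / n.+1 = j / n], coarsening subtracts the integer [j] and divides by [n.+1],
   which preserves equality of floors. *)
have E x : x / (s * n.+1%:R) - j%:R / n%:R = (x / s - j%:R / n%:R - j%:R) / n.+1%:R.
  have n1 : 1 + n%:R != 0 :> RR by rewrite gt_eqF // ltr_wpDr.
  by rewrite -[n.+1]add1n natrD; field; rewrite ?nR ?n1 ?gt_eqF.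
rewrite !E; move: (a / s - _) (b / s - _) => x y xy.
wlog suff le : x y xy / Num.floor ((x - j%:R) / n.+1%:R) <= Num.floor ((y - j%:R) / n.+1%:R).
  by apply/eqP; rewrite eq_le !le.
rewrite floor_ge_int ler_pdivlMr ?ltr0n // lerBrDr.
set m := Num.floor _.
have -> : m%:~R * n.+1%:R + j%:R = (m * n.+1%:Z + j%:Z)%:~R :> RR by rewrite intrD intrM.
rewrite -floor_ge_int -xy floor_ge_int intrD intrM -lerBrDr -ler_pdivlMr ?ltr0n //.
exact: floor_le.
Qed.

Lemma cell_coarser_exp j s a b k k' : 0 < s -> (k <= k')%N ->
  cell n j (s * n.+1%:R ^+ k) a = cell n j (s * n.+1%:R ^+ k) b ->
  cell n j (s * n.+1%:R ^+ k') a = cell n j (s * n.+1%:R ^+ k') b.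
Proof.
move=> s0 /subnKC <- ab; elim: (k' - k)%N => [|i IHi]; first by rewrite addn0.
rewrite addnS exprSr mulrA; apply: cell_coarser => //.
by rewrite mulr_gt0 // exprn_gt0 // ltr0n.
Qed.

Lemma cell_dist j s a b : 0 < s -> cell n j s a = cell n j s b -> `|a - b| <= s.
Proof.
move=> s0; rewrite /cell; have := floor_itv (a / s - j%:R / n%:R).
have := floor_itv (b / s - j%:R / n%:R) => + + E; rewrite E intrD.
move: (_%:~R) => m /andP[h1 h2] /andP[h3 h4].
have -> : a - b = (a / s - b / s) * s by rewrite -mulrBl divfK // gt_eqF.
rewrite normrM (gtr0_norm s0) ler_piMl ?(ltW s0) // ler_norml; apply/andP; split; lra.
Qed.

Lemma not_deep_near j s a : 0 < s -> ~ deep n j s a ->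
  exists z : int, `|a / s - j%:R / n%:R - z%:~R| <= (4 * n%:R)^-1.
Proof.
move=> s0 /existsNP[b /not_implyP[ba]]; rewrite /cell.
have : `|(b / s - j%:R / n%:R) - (a / s - j%:R / n%:R)| <= (4 * n%:R)^-1.
  have -> : b / s - j%:R / n%:R - (a / s - j%:R / n%:R) = (b - a) / s by rewrite mulrBl; ring.
  by rewrite normrM normfV (gtr0_norm s0) ler_pdivrMr // mulrC.
move: (b / s - _) (a / s - _) => x y xy nfl.
have := floor_itv x; have := floor_itv y => /andP[y1 y2] /andP[x1 x2].
move: xy; rewrite ler_norml => /andP[xy1 xy2].
have [lt|lt|] := ltgtP (Num.floor x) (Num.floor y); last by [].
- exists (Num.floor y).
  have : (Num.floor x + 1)%:~R <= (Num.floor y)%:~R :> RR by rewrite ler_int -ltzD1 ltrD2r.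
  rewrite ler_norml => ?; apply/andP; split; lra.
- exists (Num.floor x).
  have : (Num.floor y + 1)%:~R <= (Num.floor x)%:~R :> RR by rewrite ler_int -ltzD1 ltrD2r.
  rewrite ler_norml => ?; apply/andP; split; lra.
Qed.

(** Two failures put the difference of the shifts within [1 / (2 * n)] of an integer, whereas
    distinct shifts differ by a non-integral multiple of [1 / n]. *)
Lemma not_deep_unique j j' s a : (j < n)%N -> (j' < n)%N -> 0 < s ->
  ~ deep n j s a -> ~ deep n j' s a -> j = j'.
Proof.
move=> jn j'n s0 /(not_deep_near s0)[z zP] /(not_deep_near s0)[z' zP'].
have nR : 0 < n%:R :> RR by rewrite ltr0n.
pose m : int := j'%:Z - j%:Z + n%:Z * (z' - z).
suff m0 : m = 0.
  move: m0; rewrite /m; move: (z' - z) => w m0.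
  have [w0|w0|w0] := ltgtP w 0; last by move: m0; rewrite w0; lia.
  - have : n%:Z * w <= n%:Z * (-1) by rewrite ler_wpM2l //; lia.
    by lia.
  - have : n%:Z * 1 <= n%:Z * w by rewrite ler_wpM2l //; lia.
    by lia.
have : `|m%:~R| < 1 :> RR.
  have -> : m%:~R = n%:R * ((a / s - j%:R / n%:R - z%:~R) - (a / s - j'%:R / n%:R - z'%:~R)) :> RR.
    rewrite /m !(intrD, intrM, rmorphN) /=; field; by rewrite !gt_eqF.
  rewrite normrM gtr0_norm // -ltr_pdivlMl // mulr1.
  apply: le_lt_trans (ler_normB _ _) _.
  have : (4 * n%:R)^-1 = n%:R^-1 / 4 :> RR by field; rewrite gt_eqF.
  have : 0 < n%:R^-1 :> RR by rewrite invr_gt0.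
  lra.
by rewrite -intr_norm -[X in _ < X](mulr1z (1 : RR)) ltr_int; lia.
Qed.

End Grid.

(** Pigeonhole: each of the [d] coordinates spoils at most one of the [d.+1] shifts. *)
Lemma exists_deep (d : nat) (s : RR) (a : 'rV[RR]_d) : 0 < s ->
  exists j : 'I_d.+1, forall i, deep d.+1 j s (a 0 i).
Proof.
move=> s0; apply: contrapT => /forallNP nd.
have /choice[g gP] : forall j : 'I_d.+1, exists i, ~ deep d.+1 j s (a 0 i).
  by move=> j; apply/existsNP; exact: nd.
have ginj : injective g.
  move=> j j' gg; apply: val_inj.
  apply: (@not_deep_unique d.+1 _ j j' s (a 0 (g j))) => //.
  by rewrite gg.
by have := leq_card g ginj; rewrite !card_ord ltnn.
Qed.

Lemma exists_scale (X s b : RR) : 0 < s -> 2 <= b -> exists k, X <= s * b ^+ k.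
Proof.
move=> s0 b2; have [X0|X0] := lerP X 0.
  by exists 0; rewrite expr0 mulr1; apply: le_trans X0 (ltW s0).
have Xs : 0 <= X / s by rewrite divr_ge0 // ltW.
exists (Num.bound (X / s)); rewrite -ler_pdivrMl // mulrC.
apply: le_trans (ltW (archi_boundP Xs)) _.
have : (Num.bound (X / s) <= 2 ^ Num.bound (X / s))%N by rewrite ltnW // ltn_expl.
rewrite -(ler_nat RR) natrX => /le_trans; apply.
by rewrite lerXn2r // nnegrE; lra.
Qed.

(* Holes seen from [Q] at distance [3 * r] are shallow: this is what packing
   needs in order to treat nested sets like intersecting ones. *)
Definition shallow (d : nat) (T : Type) (K S : T -> set 'rV[RR]_d)
    (dist : T -> T -> nat) (r P : nat) (Q : T -> Prop) :=
  forall u u' w, Q u -> Q u' -> (dist u' w <= 3 * r)%N -> inside K S u w ->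
    (dist u w <= P)%N.

Section Cells.
Variables (d : nat) (c : RR) (T : finType) (K S : T -> set 'rV[RR]_d).
Variables (t : T -> RR) (adj : T -> T -> Prop) (dist : T -> T -> nat).
Hypotheses (d0 : (0 < d)%N) (c0 : 0 < c) (sys : fat_system c K S t adj dist).
Variables (r P : nat) (Q : T -> Prop).
Hypothesis Qsh : shallow K S dist r P Q.

(** [B] is the ratio of consecutive meshes, and [C] makes a mesh large enough for [r] steps to stay
    in a deep cell. In units of [scale v / (B * C)], [M] bounds the distance from [p v] to the balls
    being packed, and [N] counts boxes of side [c]. *)
Let n := d.+1.
Let B : RR := n.+1%:R.
Let C : RR := r.+1%:R * (4 * n%:R).
Let M : RR := B * C + (2 * r)%:R + 1.
Let H : nat := (Num.bound (M / c)).+1.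
Let N := #|{ffun 'I_d -> 'I_(2 * H).+1}|.

(* [big v] is a largest set within distance [r] of [v], and [scale v] is the mesh
   of the grid used around [v]. *)
Variables (big : T -> T) (p : T -> 'rV[RR]_d) (k : T -> nat) (J : T -> 'I_n) (s : RR).
Let scale v := s * B ^+ k v.
Hypothesis big_near : forall v, (dist v (big v) <= r)%N.
Hypothesis big_max : forall v u, (dist v u <= r)%N -> t u <= t (big v).
Hypothesis Kp : forall v, K v (p v).
Hypothesis s0 : 0 < s.
Hypothesis scale_lo : forall v, C * t (big v) <= scale v.
Hypothesis scale_hi : forall v, scale v <= B * (C * t (big v)).
Hypothesis J_deep : forall v i, deep n (J v) (scale v) (p v 0 i).

Let le (j : 'I_n) u v := (k u <= k v)%N /\
  forall i, cell n j (scale v) (p u 0 i) = cell n j (scale v) (p v 0 i).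
Let near u v := (dist u v <= r)%N.

Let dm : nat_metric dist. Proof. exact: dist_metric sys. Qed.
Let B0 : 0 < B. Proof. by rewrite ltr0n. Qed.
Let B1 : 1 <= B. Proof. by rewrite ler1n. Qed.
Let C0 : 0 < C. Proof. by rewrite mulr_gt0 // mulr_gt0. Qed.

Lemma scale_gt0 v : 0 < scale v.
Proof. by rewrite mulr_gt0 // exprn_gt0. Qed.

Lemma cells_forest j : forest_order (le j).
Proof.
split=> [x|x y z [xy cxy] [yz cyz]|u a b [ua ca] [ub cb]]; first by split.
  split=> [|i]; first exact: leq_trans yz.
  by rewrite -cyz; exact: (cell_coarser_exp _ s0 yz (cxy i)).
have [ab|/ltnW ba] := leqP (k a) (k b); [left|right]; split=> // i.
- by rewrite -cb; exact: (cell_coarser_exp _ s0 ab (esym (ca i))).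
- by rewrite -ca; exact: (cell_coarser_exp _ s0 ba (esym (cb i))).
Qed.

Lemma near_cell u v i : near u v ->
  cell n (J u) (scale u) (p v 0 i) = cell n (J u) (scale u) (p u 0 i).
Proof.
have [dd dC dt] := dm; move=> uv; apply: J_deep.
have := walk_displacement (b := t (big u)) sys (sys_walk sys u v) (Kp u) (Kp v).
move=> uvd; apply: le_trans (_ : r.+1%:R * t (big u) <= _); last first.
  rewrite ler_pdivlMr ?mulr_gt0 ?ltr0n //; apply: le_trans (scale_lo u).
  by rewrite /C mulrAC.
have -> : p v 0 i - p u 0 i = - (p u - p v) 0 i by rewrite !mxE opprB.
rewrite normrN; apply: le_trans (coord_le_norm _ _) _.
apply: le_trans (uvd _) _ => [z uz|]; first by apply: big_max; exact: leq_trans uv.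
by rewrite ler_wpM2r ?(sys_size_ge0 sys) // ler_nat.
Qed.

Lemma cells_comparability j :
  comparability_graph dist (fun v => Q v /\ J v = j) (le j) near r.
Proof.
have [dd dC dt] := dm.
split=> [x|x y|x y [_ Jx] [_ Jy] xy]; first by rewrite /near dd.
  by rewrite /near dC.
split=> //; have [kxy|/ltnW kyx] := leqP (k x) (k y); [left|right]; split=> // i.
- by rewrite -Jy near_cell // /near dC.
- by rewrite -Jx near_cell.
Qed.

Lemma inside_or_near m x u w : walk adj m x u -> inside K S x w ->
  inside K S u w \/ (dist u w <= m.+1)%N.
Proof.
have [dd dC dt] := dm; elim: m x => [x <-|m IHm x [z [xz zu]] xw]; first by left.
have [zw|nzw] := pselect (adj z w).
  right; have := adj_dist sys zw; have := sys_dist sys zu.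
  by have := dt u z w; rewrite (dC u z); lia.
have zw' : z <> w by move=> zw; apply: (inside_not_adj sys xw); rewrite -zw.
have [|uw] := IHm _ zu (inside_step sys xw xz zw' nzw); first by left.
by right; lia.
Qed.

(** The sets of the bag may be small themselves. On the walk from [y], whose point [p y] is in the
    cell of [v], through [u] to [big u], the first set of size at least [s1] is near that cell and
    contains a ball of radius [c * s1]. *)
Lemma big_marker j v u : bag (fun v => Q v /\ J v = j) (le j) near v u ->
  exists x q, [/\ (dist u x <= 3 * r)%N,
    `|q - p v| <= M * (scale v / (B * C)) &
    forall y, `|y - q| <= c * (scale v / (B * C)) -> K x y].
Proof.
have [dd dC dt] := dm.
move=> [_ [kvu _] [y [_ [kyv cy] uy]]]; set s1 := scale v / (B * C).
have s10 : 0 < s1 by rewrite divr_gt0 ?scale_gt0 ?mulr_gt0.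
have tbig : s1 <= t (big u).
  rewrite ler_pdivrMr ?mulr_gt0 // mulrC -mulrA; apply: le_trans (scale_hi u).
  by rewrite ler_wpM2l ?(ltW s0) // ler_weXn2l.
have w := walk_cat (sys_walk sys y u) (sys_walk sys u (big u)).
have [x [z [sx Kz yz yx]]] := walk_first_big sys tbig (ltW s10) w (Kp y).
have [q qK] := sys_fat sys (lt_le_trans s10 sx).
have Kcvx : Defs.convex_set (K x) by exact: (sys_convex sys).
have Ksize a b : K x a -> K x b -> `|a - b| <= t x by exact: (sys_size sys).
have [q' q'z q'K] := fat_ball_near Kcvx c0 s10 sx Ksize qK Kz.
exists x, q'; split=> //.
  by move: uy; rewrite /near => uy; have := big_near u; have := dt u y x; move: yx; rewrite (dC y u); lia.
have -> : q' - p v = (q' - z) - (p y - z) + (p y - p v) by rewrite opprB !addrA !subrK.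
apply: le_trans (ler_normD _ _) _; apply: le_trans (lerD (ler_normB _ _) (lexx _)) _.
have -> : M * s1 = s1 + (2 * r)%:R * s1 + scale v.
  rewrite /M /s1; field; by rewrite !gt_eqF.
rewrite !lerD //.
  apply: le_trans yz _; rewrite ler_wpM2r ?(ltW s10) // ler_nat.
  by move: uy; rewrite /near (dC u y) => uy; have := big_near u; lia.
apply: norm_le_coord => [|i]; first by rewrite ltW ?scale_gt0.
by rewrite !mxE; apply: cell_dist (cy i) => //; exact: scale_gt0.
Qed.

(** On the way from [x] to [u], either the hole of [x'] is never left and shallowness applies to
    [u], or the walk passes next to [x']. *)
Lemma inside_close u u' x x' : Q u -> Q u' -> (dist u x <= 3 * r)%N ->
  (dist u' x' <= 3 * r)%N -> inside K S x x' -> (dist u u' <= P + 6 * r + 1)%N.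
Proof.
have [dd dC dt] := dm; move=> Qu Qu' ux ux' xx'.
have [|uw] := inside_or_near (sys_walk sys x u) xx'.
- by move=> /(Qsh Qu Qu' ux'); have := dt u x' u'; rewrite (dC x' u'); lia.
- by have := dt u x' u'; move: uw; rewrite (dC x' u') (dC x u); lia.
Qed.

Lemma cells_covered j v :
  covered dist N (P + 6 * r + 1)%N (bag (fun v => Q v /\ J v = j) (le j) near v).
Proof.
have [dd dC dt] := dm; set X := bag _ _ _ _.
have /choice[x /choice[q xqP]] : forall u, exists x q, X u -> [/\ (dist u x <= 3 * r)%N,
    `|q - p v| <= M * (scale v / (B * C)) &
    forall y, `|y - q| <= c * (scale v / (B * C)) -> K x y].
  move=> u; have [/big_marker[x [q xqP]]|nX] := pselect (X u); first by exists x, q.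
  by exists u, 0.
set s1 := scale v / (B * C) in xqP.
have s10 : 0 < s1 by rewrite divr_gt0 ?scale_gt0 ?mulr_gt0.
have cs0 : 0 < c * s1 by rewrite mulr_gt0.
(* The classes are boxes of side [c * s1]: if [q u] and [q u'] share a box, then [q u'] lies in both
   hulls and [meet_or_inside] applies. *)
pose fl u i := Num.floor ((q u 0 i - p v 0 i) / (c * s1)).
pose f u : {ffun 'I_d -> 'I_(2 * H).+1} := [ffun i => inord (absz (fl u i + H%:Z))].
have flH u i : X u -> - H%:Z <= fl u i <= H%:Z.
  move=> /xqP[_ qp _].
  have : `|(q u 0 i - p v 0 i) / (c * s1)| <= M / c.
    rewrite normrM normfV (gtr0_norm cs0) ler_pdivrMr //.
    have -> : M / c * (c * s1) = M * s1 by rewrite mulrA divfK ?gt_eqF.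
    by apply: le_trans qp; rewrite -[X in `|X|](_ : (q u - p v) 0 i = _) ?coord_le_norm ?mxE.
  have Mc : 0 <= M / c.
    by rewrite divr_ge0 ?(ltW c0) // !addr_ge0 ?ler0n // mulr_ge0 // ltW.
  have := archi_boundP Mc; rewrite ler_norml /fl => bd /andP[h1 h2].
  have Hb : (Num.bound (M / c))%:R + 1 = H%:R :> RR by rewrite /H natr1.
  rewrite floor_ge_int rmorphN /=; apply/andP; split; first by move: h1 bd Hb; rewrite -pmulrn; lra.
  rewrite -(ler_int RR); apply: le_trans (floor_le _) _; rewrite -pmulrn; lra.
exists (fun u => nat_of_ord (enum_rank (f u))); split=> [u _|u u' Xu Xu' /val_inj/enum_rank_inj ff].
  exact: ltn_ord.
have [ux qu Ku] := xqP _ Xu; have [ux' qu' Ku'] := xqP _ Xu'.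
have Kq' : K (x u) (q u').
  apply: Ku; apply: norm_le_coord => [|i]; first exact: ltW.
  have fle : fl u i = fl u' i.
    have := flH _ i Xu; have := flH _ i Xu'.
    have /ffunP/(_ i)/(congr1 val) := ff; rewrite !ffunE /=.
    move: (fl u i) (fl u' i) => a b.
    by move=> E /andP[b1 b2] /andP[a1 a2]; move: E; rewrite !inordK; lia.
  have := floor_itv ((q u 0 i - p v 0 i) / (c * s1)).
  have := floor_itv ((q u' 0 i - p v 0 i) / (c * s1)).
  rewrite -/(fl u i) -/(fl u' i) fle intrD; move: (_%:~R) => m /andP[h1 h2] /andP[h3 h4].
  have -> : (q u' - q u) 0 i = ((q u' 0 i - p v 0 i) / (c * s1) - (q u 0 i - p v 0 i) / (c * s1)) * (c * s1).
    by rewrite -mulrBl divfK ?gt_eqF // !mxE; ring.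
  rewrite normrM (gtr0_norm cs0) ler_piMl ?(ltW cs0) // ler_norml; apply/andP; split; lra.
have Kq'' : K (x u') (q u').
  by apply: Ku'; rewrite subrr normr0 ltW.
have [[Qu _] _ _] := Xu; have [[Qu' _] _ _] := Xu'.
have [meet|nmeet] := pselect (S (x u) `&` S (x u') !=set0).
  have := meet_dist sys meet; have := dt u (x u) u'; have := dt (x u) (x u') u'.
  by rewrite (dC (x u') u'); lia.
have [xx'|x'x] := meet_or_inside sys d0 Kq' Kq'' nmeet.
  exact: (inside_close Qu Qu' ux ux' xx').
by rewrite dC; exact: (inside_close Qu' Qu ux' ux x'x).
Qed.

Lemma cells_coloring (F : nat) :
  (forall (U : T -> Prop) le' G,
    nat_metric dist -> forest_order le' -> comparability_graph dist U le' G r ->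
    (forall v, U v -> covered dist N (P + 6 * r + 1)%N (bag U le' G v)) ->
    exists chi : T -> bool, mono_bounded dist U G chi F) ->
  exists chi : T -> 'I_n * bool, mono_bounded dist Q near chi F.
Proof.
move=> tree; have [dd _ _] := dm.
have /choice[chi chiP] : forall j : 'I_n, exists chi : T -> bool,
    mono_bounded dist (fun v => Q v /\ J v = j) near chi F.
  move=> j; apply: (tree _ (le j)) => //; first exact: cells_forest.
    exact: cells_comparability.
  by move=> v _; exact: cells_covered.
exists (fun v => (J v, chi (J v) v)) => x y xy; apply: (chiP (J x)).
suff [] : chain (mono_step (fun v => Q v /\ J v = J x) near (chi (J x))) x y /\ J y = J x by [].
elim: xy => [|a b [Qa Qb [Jab chiab] ab] _ [xa Ja]]; first by split=> //; exact: chain0.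
rewrite -Jab Ja in chiab *; split=> //; apply: (chainS xa); split=> //; split=> //.
by rewrite -Jab.
Qed.

End Cells.

Lemma degenerate_system (d : nat) (c : RR) (T : finType) (K S : T -> set 'rV[RR]_d) t adj dist :
  fat_system c K S t adj dist -> (forall i, t i <= 0) -> forall u v, (dist u v <= 1)%N.
Proof.
move=> sys t0 u v; have [m] : exists m, walk adj m u v by exists (dist u v); exact: (sys_walk sys).
elim: m u => [u ->|m IHm u [z [uz /IHm]]]; first by have [-> _ _] := dist_metric sys.
case/(dist_le1 sys) => [<-|zv]; first exact: (adj_dist sys uz).
have [_ [x [Sux Szx]]] := (sys_adj sys u z).1 uz.
have [_ [y [Szy Svy]]] := (sys_adj sys z v).1 zv.
apply: (meet_dist sys); exists y; split=> //; suff <- : x = y by [].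
apply/eqP; rewrite -subr_eq0 -normr_le0; apply: le_trans (t0 z).
by apply: (sys_size sys); exact: (sys_sub sys).
Qed.

Theorem shallow_coloring (d : nat) (c : RR) (r P : nat) : (0 < d)%N -> 0 < c ->
  exists F, forall (T : finType) (K S : T -> set 'rV[RR]_d) t adj dist,
  fat_system c K S t adj dist -> (0 < r)%N -> forall Q, shallow K S dist r P Q ->
  exists chi : T -> 'I_d.+1 * bool,
    mono_bounded dist Q (fun u v => (dist u v <= r)%N) chi F.
Proof.
move=> d0 c0.
pose B : RR := d.+2%:R; pose C : RR := r.+1%:R * (4 * d.+1%:R).
pose H := (Num.bound ((B * C + (2 * r)%:R + 1) / c)).+1.
have [F FP] := tree_coloring #|{ffun 'I_d -> 'I_(2 * H).+1}| r (P + 6 * r + 1)%N.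
(* The successor allows for systems of single points, where distances are at most 1. *)
exists F.+1 => T K S t adj dist sys r0 Q Qsh.
have [[i0 ti0]|nopos] := pselect (exists i, 0 < t i); last first.
  exists (fun=> (ord0, true)) => x y _; apply: leq_trans (_ : 1 <= _)%N => //.
  apply: (degenerate_system sys) => i; rewrite leNgt; apply/negP => ti.
  by apply: nopos; exists i.
have [dd dC dt] := dist_metric sys.
have B2 : 2 <= B by rewrite ler_nat.
have C0 : 0 < C by rewrite !mulr_gt0.
have /choice[big bigP] : forall v, exists w, [/\ (dist v w <= r)%N, 0 < t w &
    forall u, (dist v u <= r)%N -> t u <= t w].
  move=> v; have vv : (fun u => dist v u <= r)%N v by rewrite dd.
  case: (@arg_maxP _ _ _ v (fun u => dist v u <= r)%N t vv) => w vw wmax.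
  exists w; split=> //; have [w' vw' tw'] := positive_near sys v ti0.
  by apply: lt_le_trans tw' (wmax _ _); exact: leq_trans r0.
have /choice[p pP] : forall v, exists p, K v p by move=> v; exact: (sys_nonempty sys v c0 ti0).
(* The least mesh wanted by any vertex, so that natural exponents suffice and overshoot by a factor
   of at most [B]. *)
pose s := \big[Order.min/C * t (big i0)]_v (C * t (big v)).
have s0 : 0 < s.
  apply: lt_bigmin => [|v _]; rewrite mulr_gt0 //; first by have [] := bigP i0.
  by have [] := bigP v.
have sle v : s <= C * t (big v) by exact: bigmin_le_cond.
have /choice[k kP] : forall v, exists k, C * t (big v) <= s * B ^+ k /\
    s * B ^+ k <= B * (C * t (big v)).
  move=> v; pose A k := C * t (big v) <= s * B ^+ k.
  have exA : exists k, A k by exact: exists_scale.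
  have [k Ak kmin] := ex_minnP exA; exists k; split=> //.
  case: k Ak kmin => [|k] Ak kmin.
    rewrite expr0 mulr1; apply: le_trans (sle v) _; apply: ler_peMl.
      by rewrite ltW // (lt_le_trans s0).
    by apply: le_trans B2; rewrite ler1n.
  rewrite exprS mulrCA ler_wpM2l ?ler0n //.
  by rewrite ltW // ltNge; apply/negP => /kmin; rewrite ltnn.
have /choice[J JP] : forall v, exists j : 'I_d.+1,
    forall i, deep d.+1 j (s * B ^+ k v) (p v 0 i).
  by move=> v; apply: exists_deep; rewrite mulr_gt0 // exprn_gt0 //; lra.
have [chi chiP] := @cells_coloring d c T K S t adj dist d0 c0 sys r P Q Qsh big p k J s
  (fun v => let: And3 h _ _ := bigP v in h) (fun v => let: And3 _ _ h := bigP v in h)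
  pP s0 (fun v => (kP v).1) (fun v => (kP v).2) JP F (FP T dist).
by exists chi => x y /chiP /leqW.
Qed.

(** * Layers *)

Section Outer.
Variables (d : nat) (c : RR) (T : finType) (K S : T -> set 'rV[RR]_d).
Variables (t : T -> RR) (adj : T -> T -> Prop) (dist : T -> T -> nat).
Hypothesis sys : fat_system c K S t adj dist.
Variables (v0 : T) (r : nat).
Hypothesis v0_out : forall w, ~ inside K S v0 w.
Hypothesis r0 : (0 < r)%N.
Local Open Scope nat_scope.

(** As [L] exceeds [3 * r], a vertex is farther than [3 * r] from every [w] among its deep holes. *)
Let L := 3 * r + 3.
Let l v := dist v0 v.
Let m v := l v %/ L.
Let near u v := dist u v <= r.

Definition deep_holes (v : T) : {set T} :=
  [set w | `[< inside K S v w /\ l w < (m v).-1 * L >]].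

(* The vertices at the start of a layer for which a hole has just become deep; off
   them [deep_holes] is locally constant. *)
Definition transitional (v : T) := l v %% L < r /\
  exists w, [/\ inside K S v w, (m v).-2 * L <= l w & l w < (m v).-1 * L].

Let dm : nat_metric dist. Proof. exact: dist_metric sys. Qed.

Lemma layer_bounds v : m v * L <= l v < m v * L + L.
Proof.
have L0 : 0 < L by rewrite /L; lia.
have := divn_eq (l v) L; have := ltn_pmod (l v) L0; rewrite -/(m v); lia.
Qed.

Lemma layer_lip u v : near u v -> l v <= l u + r.
Proof. by have [_ _ dt] := dm; have := dt v0 u v; rewrite /near /l; lia. Qed.

Lemma near_sym u v : near u v -> near v u.
Proof. by have [_ dC _] := dm; rewrite /near dC. Qed.

Lemma inside_near k u v w : near u v -> k * L <= l u + r -> inside K S u w ->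
  l w < k.-1 * L -> inside K S v w.
Proof.
case: k => [|k] uv ku uw lw; first by rewrite mul0n in lw.
apply: (inside_stay sys (v0 := v0) (sys_walk sys u v) uw); rewrite -/(l w) -/(l u).
by move: uv ku lw; rewrite /near /L mulSn /=; lia.
Qed.

(** Inside a layer, holes this deep survive steps of length [r]. Crossing into the next layer raises
    the threshold, and a hole made deep by this would make the later vertex transitional. *)
Lemma deep_holes_const u v : near u v -> ~ transitional u -> ~ transitional v ->
  deep_holes u = deep_holes v.
Proof.
wlog uvm : u v / m u <= m v => [key uv nu nv|uv nu nv].
  by have [/key|/ltnW/key H] := leqP (m u) (m v); [exact|rewrite H //; exact: near_sym].
have := layer_bounds u; have := layer_bounds v => /andP[v1 v2] /andP[u1 u2].
have lv := layer_lip uv; have lu := layer_lip (near_sym uv).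
have stay k w : k = m u -> inside K S u w /\ l w < k.-1 * L <-> inside K S v w /\ l w < k.-1 * L.
  move=> ->; have mL : m u * L <= m v * L by rewrite leq_mul2r uvm orbT.
  split=> -[iw lw]; split => //.
    by apply: (inside_near uv _ iw lw); lia.
  by apply: (inside_near (near_sym uv) _ iw lw); lia.
apply/setP => w; rewrite !inE; apply: asbool_equiv_eq.
have [E|ne] := eqVneq (m u) (m v); first by rewrite -E; exact: stay.
have E : m v = (m u).+1.
  have h : (m u).+1 <= m v by rewrite ltn_neqAle ne.
  apply/eqP; rewrite eqn_leq h andbT leqNgt; apply/negP => h2.
  have : (m u).+2 * L <= m v * L by rewrite leq_mul2r h2 orbT.
  by move: u2 v1 lv; rewrite !mulSn /L; lia.
rewrite E /=; split=> [/(stay _ _ erefl)[iw lw]|[iw lw]].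
  by split=> //; apply: leq_trans lw _; rewrite leq_mul2r leq_pred orbT.
apply/(stay _ _ erefl); split => //; rewrite ltnNge; apply/negP => lw'.
apply: nv; split; last by exists w; rewrite E.
have := divn_eq (l v) L; rewrite -/(m v) E mulSn; lia.
Qed.

(** Since [2 * r < L], the chain never reaches the start of another layer. So all its vertices stay
    in a hole of one [w], within [3 * L + 2] of it by [inside_layer]. *)
Lemma transitional_bounded x y :
  chain (fun a b => [/\ transitional a, transitional b & near a b]) x y ->
  dist x y <= 6 * L + 4.
Proof.
have [dd dC dt] := dm; move=> xy.
have [[_ [w [xw lw lw']]]|nx] := pselect (transitional x); last first.
  suff -> : x = y by rewrite dd.
  elim: xy => // a b [ta _ _] _ xa; by rewrite -xa in ta.
have close z : m z = m x -> inside K S z w -> dist z w <= 3 * L + 2.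
  move=> mz /(inside_layer sys v0_out)[_]; rewrite -/(l w) -/(l z).
  have := layer_bounds z; rewrite mz => /andP[_].
  move: lw; case: (m x) => [|[|k]] /=; rewrite ?mulSn ?mul0n; lia.
suff [my iy] : m y = m x /\ inside K S y w.
  by have := close _ my iy; have := close _ erefl xw; have := dt x w y; rewrite (dC w y); lia.
elim: xy => // a b [ta tb ab] _ [ma aw].
have := layer_bounds a; have := layer_bounds b => /andP[b1 b2] /andP[a1 a2].
have [ra _] := ta; have [rb _] := tb.
have la := divn_eq (l a) L; have lb := divn_eq (l b) L; rewrite -/(m a) in la; rewrite -/(m b) in lb.
have lab := layer_lip ab; have lba := layer_lip (near_sym ab).
have mm u v : l u = m u * L + l u %% L -> l u %% L < r -> l v <= l u + r -> m v * L <= l v ->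
    m v <= m u.
  move=> h1 h2 h3 h4; rewrite leqNgt; apply/negP => uv.
  have : (m u).+1 * L <= m v * L by rewrite leq_mul2r uv orbT.
  by have : 2 * r < L by [rewrite /L; lia]; rewrite mulSn; lia.
have E : m b = m a by apply/eqP; rewrite eqn_leq !mm.
split; first by rewrite E.
by apply: (inside_near ab _ aw (k := m x)) => //; rewrite -ma; lia.
Qed.

(** Different values of [deep_holes] may share colours, as no step between vertices that are not
    transitional changes the value; [None] is the extra colour of the transitional vertices. *)
Lemma layered_coloring (C : finType) (F : nat) :
  (forall Q, shallow K S dist r (2 * L + 2) Q ->
    exists chi : T -> C, mono_bounded dist Q near chi F) ->
  exists chi : T -> option C,
    mono_bounded dist (fun=> True) near chi (F + (6 * L + 4)).
Proof.
have [dd dC dt] := dm; move=> sh.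
have /choice[X XP] : forall W : {set T}, exists chi : T -> C,
    mono_bounded dist (fun v => ~ transitional v /\ deep_holes v = W) near chi F.
  move=> W; apply: sh => u u' w [_ Wu] [_ Wu'] u'w uw.
  have /andP[u1 u2] := layer_bounds u; have /andP[u'1 u'2] := layer_bounds u'.
  (* A deep hole is shared by [u'] and thus too far from it; any other hole is close to [u] by
     [inside_layer]. *)
  have [lw|lw] := ltnP (l w) ((m u).-1 * L).
    have : w \in deep_holes u' by rewrite Wu' -Wu inE; exact/asboolP.
    rewrite inE => /asboolP[_ lw']; have := dt v0 w u'.
    move: u'1 lw'; rewrite (dC w u') -/(l w) -/(l u') /L.
    by case: (m u') => [|k] /=; rewrite ?mul0n ?mulSn; lia.
  have [_] := inside_layer sys v0_out uw; rewrite -/(l w) -/(l u).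
  by move: u2 lw; case: (m u) => [|k] /=; rewrite ?mul0n ?mulSn; lia.
exists (fun v => if `[< transitional v >] then None else Some (X (deep_holes v) v)).
move=> x y xy.
have [tx|nx] := pselect (transitional x).
  apply: leq_trans (leq_addl _ _); apply: transitional_bounded.
  suff [] : transitional y /\
    chain (fun a b => [/\ transitional a, transitional b & near a b]) x y by [].
  elim: xy => [|a b [_ _ cab ab] _ [ta xa]]; first by split=> //; exact: chain0.
  have tb : transitional b by move: cab; rewrite asboolT //; case: asboolP.
  by split=> //; apply: (chainS xa).
apply: leq_trans (leq_addr _ _); apply: (XP (deep_holes x)).
suff [] : (~ transitional y /\ deep_holes y = deep_holes x) /\
  chain (mono_step (fun v => ~ transitional v /\ deep_holes v = deep_holes x) near
    (X (deep_holes x))) x y by [].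
elim: xy => [|a b [_ _ cab ab] _ [[na Wa] xa]]; first by split=> //; exact: chain0.
have nb : ~ transitional b by move: cab; rewrite asboolF //; case: asboolP.
have Wb : deep_holes b = deep_holes x by rewrite -Wa; apply/esym; exact: deep_holes_const.
split=> //; apply: (chainS xa); split=> //.
by move: cab; rewrite !asboolF // Wa Wb => -[].
Qed.

End Outer.

(** * From colourings to covers *)

Lemma gdistE (T : Type) (adj : T -> T -> Prop) (dist : T -> T -> nat) x y :
  (forall x y, walk adj (dist x y) x y) ->
  (forall k x y, walk adj k x y -> (dist x y <= k)%N) ->
  gdist adj x y = (dist x y)%:R.
Proof.
move=> w wmin; apply/eqP; rewrite eq_le; apply/andP; split.
  apply: ge_inf; first by exists 0 => _ [k _ <-]; exact: ler0n.
  by exists (dist x y) => //=; exact: w.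
apply: lb_le_inf; first by exists (dist x y)%:R; exists (dist x y) => //=; exact: w.
by move=> _ [k /= /wmin kxy <-]; rewrite ler_nat.
Qed.

(** Each colour gives the family of its monochromatic components: vertices of one colour at distance
    at most [r] lie in the same component. *)
Lemma good_cover_coloring (T : Type) (adj : T -> T -> Prop) (dist : T -> T -> nat)
    (C : finType) (n r F : nat) (x D : RR) (chi : T -> C) :
  (forall x y, walk adj (dist x y) x y) ->
  (forall k x y, walk adj k x y -> (dist x y <= k)%N) ->
  nat_metric dist -> #|C| = n.+1 ->
  mono_bounded dist (fun=> True) (fun u v => (dist u v <= r)%N) chi F ->
  x <= r%:R -> F%:R <= D -> good_cover adj n x D.
Proof.
move=> w wmin [dd dC dt] Cn bnd xr FD.
pose near u v := (dist u v <= r)%N.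
pose step := mono_step (fun=> True) near chi.
have stepC a b : step a b -> step b a by case=> _ _ ab; rewrite /near dC => ba; split.
pose comp v : set T := [set u | chain step v u].
exists (fun i => [set A | exists2 v, enum_rank (chi v) = i :> nat & A = comp v]).
split=> [v|].
  have h : (enum_rank (chi v) < n.+1)%N by rewrite -Cn.
  by exists (Ordinal h), (comp v); split; [exists v|exact: chain0].
split=> i.
- move=> _ _ [u ui ->] [v vi ->] uv a b ua vb; rewrite (gdistE _ _ w wmin).
  apply: le_lt_trans xr _; rewrite ltr_nat ltnNge; apply/negP => ab.
  apply: uv; have chiE p q : chain step p q -> chi q = chi p.
    by elim=> // p' q' [_ _ <-] _ _ ->.
  have cuv : chi u = chi v by apply: enum_rank_inj; apply: val_inj; rewrite /= ui.
  have {}ab : step a b by split => //; rewrite (chiE _ _ ua) (chiE _ _ vb).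
  have uv : chain step u v.
    exact: chain_trans (chainS ua ab) (chain_sym stepC vb).
  apply/seteqP; split=> q /=; first exact: chain_trans (chain_sym stepC uv).
  exact: chain_trans uv.
- move=> _ [v vi ->] a b va vb; rewrite (gdistE _ _ w wmin); apply: le_trans FD.
  by rewrite ler_nat; apply: bnd; exact: chain_trans (chain_sym stepC va) vb.
Qed.

Lemma class_fat_system (d : nat) (alpha : RR) : (0 < d)%N -> 1 <= alpha ->
  exists2 c, 0 < c & forall m (S : 'I_m -> set 'rV[RR]_d), in_class alpha S ->
    exists K t dist, fat_system c K S t (inter_adj S) dist.
Proof.
move=> d0 al1; have [c c0 fat] := fat_ball d0 al1; exists c => // m S [adm conn].
have [dist [w wmin]] := graph_distance conn.
have /choice[K KP] : forall i, exists K : set 'rV[RR]_d,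
    [/\ compact K, Defs.convex_set K, aspect_ratio_le K alpha, S i `<=` K &
    forall x, K x -> ~ K° x -> S i x].
  move=> i; have [_ [K [Z [? [? [? [ZK ->]]]]]]] := adm i; exists K; split=> //
    x Kx nKx; by split=> // /ZK.
exists K, (fun i => diam (K i)), dist; split=> //.
- by move=> i; have [] := KP i.
- by move=> i; have [] := KP i.
- by move=> i; have [] := adm i.
- by move=> i; have [] := KP i.
- by move=> i x; have [_ _ _ _ bK] := KP i; exact: bK.
- move=> i; have [Ki _ _ _ _] := KP i; have [[x Kx]|ne] := pselect (K i !=set0).
    by have := norm_le_diam Ki Kx Kx; rewrite subrr normr0.
  rewrite /diam (_ : [set _ | _ in _ & _ in _] = set0) ?sup0 //.
  by apply/seteqP; split=> // z [x Kx _]; case: ne; exists x.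
- by move=> i x y; have [Ki _ _ _ _] := KP i; exact: norm_le_diam.
- by move=> i; have [Ki1 Ki2 Ki3 _ _] := KP i; exact: fat.
Qed.

Theorem theorem5p5 (d : nat) (alpha : RR) :
  (0 < d)%N -> 1 <= alpha -> asdim_le d alpha (2 * d + 2)%N.
Proof.
move=> d0 al1; have [c c0 csys] := class_fat_system d0 al1.
have /choice[F FP] : forall r, exists F, forall (T : finType) (K S : T -> set 'rV[RR]_d) t adj dist,
  fat_system c K S t adj dist -> (0 < r)%N ->
  forall Q, shallow K S dist r (2 * (3 * r + 3) + 2)%N Q ->
  exists chi : T -> 'I_d.+1 * bool,
    mono_bounded dist Q (fun u v => (dist u v <= r)%N) chi F.
  by move=> r; exact: shallow_coloring.
exists (fun x => let r := (Num.trunc x).+1 in (F r + (6 * (3 * r + 3) + 4))%:R).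
split=> [x _|m S /csys[K [t [dist sys]]] x x0]; first exact: ler0n.
have [[v _]|nov] := pselect (exists v : 'I_m, True); last first.
  exists (fun=> set0); split=> [v|]; first by case: nov; exists v.
  by split=> i A.
have [v0 v0_out] := outermost sys v d0.
set r := (Num.trunc x).+1.
have [chi chiP] := layered_coloring sys v0_out (isT : (0 < r)%N)
  (FP r _ _ _ _ _ _ sys isT).
apply: (good_cover_coloring _ _ (dist_metric sys) _ chiP) => //.
- exact: (sys_walk sys).
- exact: (sys_dist sys).
(* [2 * (d + 1)] colours and the transitional one make [2 * d + 3], one more than the dimension. *)
- by rewrite card_option card_prod card_ord card_bool; lia.
- by have /andP[_ /ltW] := truncn_itv (ltW x0).
Qed.
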